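(* Let $n\geq 1$ be an integer, and let $D_n$ be the $n$-th diamond poset. Let $k$ be a field, $S_n=k[y_1,\ldots,y_{4n}]$ and $T_n=k[x_1,\ldots,x_{3n+1}]$, with $I_{\mathrm{LD}}(D_n)\subseteq S_n$ and $I_{2n+1}(D_n)\subseteq T_n$. Then $\beta_{0,0}(S_n/I_{\mathrm{LD}}(D_n))=1$ and, for $1\leq i\leq n+1$, $$\beta_{i,j}(S_n/I_{\mathrm{LD}}(D_n))=\begin{cases}\binom{n}{i-1}2^{n-i+1}, & \text{if } j=2i+2n-2,\\ 0, & \text{otherwise.}\end{cases}$$ Moreover, $\beta_{i,j}(S_n/I_{\mathrm{LD}}(D_n))=0$ for $i>n+1$. Similarly, $\beta_{0,0}(T_n/I_{2n+1}(D_n))=1$ and, for $1\leq i\leq n+1$, $$\beta_{i,j}(T_n/I_{2n+1}(D_n))=\begin{cases}\binom{n}{i-1}2^{n-i+1}, & \text{if } j=i+2n,\\ 0, & \text{otherwise.}\end{cases}$$ Moreover, $\beta_{i,j}(T_n/I_{2n+1}(D_n))=0$ for $i>n+1$. In particular, both $S_n/I_{\mathrm{LD}}(D_n)$ and $T_n/I_{2n+1}(D_n)$ have a pure resolution.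
   Context: For posets $P,Q$ on disjoint ground sets, $P\oplus Q$ is the poset on the union in which $x<y$ iff $x<_P y$, or $x<_Q y$, or $x\in P$ and $y\in Q$. $D_1$ is the poset on $\{x_1,x_2,x_3,x_4\}$ with cover relations $x_1<x_2$, $x_1<x_3$, $x_2<x_4$, $x_3<x_4$. For $n\geq 2$, $D_n=\widetilde D_{n-1}\oplus D_1$, where $\widetilde D_{n-1}$ is $D_{n-1}$ with its maximum element removed. Thus $D_n$ consists of $n$ diamonds piled on top of each other; it has $3n+1$ elements, identified with $x_1,\ldots,x_{3n+1}$, and $4n$ cover relations (edges of the Hasse diagram), identified with $y_1,\ldots,y_{4n}$. $I_{\mathrm{LD}}(D_n)\subseteq S_n$ is the ideal generated by the monomials $\prod_{e\in\pi}y_e$, where $\pi$ runs over the maximal saturated chains of $D_n$ and the product is over the cover relations (edges) of $\pi$. $I_{2n+1}(D_n)\subseteq T_n$ is the path ideal generated by the monomials $\prod_{v\in\pi}x_v$, where $\pi$ runs over the saturated chains with $2n+1$ elements (these are the maximal chains) and the product is over the elements of $\pi$. $\beta_{i,j}$ denotes the $\mathbb{Z}$-graded Betti numbers; $k$ is arbitrary. *)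

(* Defs.v *)
From HB Require Import structures.
From Stdlib Require Import ClassicalEpsilon.
From mathcomp Require Import all_boot all_order all_algebra.
From mathcomp Require Import mpoly.

Set Implicit Arguments.
Unset Strict Implicit.
Unset Printing Implicit Defensive.

Import Order.TTheory GRing.Theory.

Section OrdinalSum.
Context {d : Order.disp_t}.

Definition osum (P Q : finPOrderType d) : Type := (P + Q)%type.

Context (P Q : finPOrderType d).

HB.instance Definition _ := Finite.on (osum P Q).

Definition osum_lt (u v : osum P Q) : bool :=
  match u, v with
  | inl x, inl y => (x < y)%O
  | inr x, inr y => (x < y)%O
  | inl _, inr _ => true
  | inr _, inl _ => false
  end.

Lemma osum_lt_irr : irreflexive osum_lt.
Proof. by case=> x /=; rewrite ltxx. Qed.

Lemma osum_lt_trans : transitive osum_lt.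
Proof. by case=> y; case=> x; case=> z //=; apply: lt_trans. Qed.

HB.instance Definition _ :=
  Order.Lt_isPOrder.Build d (osum P Q) osum_lt_irr osum_lt_trans.

End OrdinalSum.

Section RemoveMaximum.
Context {d : Order.disp_t} (P : finPOrderType d).

Definition is_maximum (x : P) : bool := [forall y : P, (y <= x)%O].

Definition remove_max : Type := {x : P | ~~ is_maximum x}.

HB.instance Definition _ := Finite.on remove_max.
HB.instance Definition _ := SubChoice.on remove_max.
HB.instance Definition _ := [SubChoice_isSubPOrder of remove_max by <: with d].

End RemoveMaximum.

(* The elements x_1, x_2, x_3, x_4 of D_1 are 0, 1, 2, 3 : 'I_4;
   [D1_covers] checks that the cover relations are the intended ones. *)
Fact diamond_display : Order.disp_t. Proof. exact: Order.Disp tt tt. Qed.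

Definition D1 : Type := 'I_4.

HB.instance Definition _ := Finite.on D1.

Definition D1_lt (x y : D1) : bool :=
  (val x, val y) \in [:: (0, 1); (0, 2); (1, 3); (2, 3); (0, 3)]%N.

Lemma D1_lt_irr : irreflexive D1_lt.
Proof. by case; do 4?[case=> //]. Qed.

Lemma D1_lt_trans : transitive D1_lt.
Proof.
by move=> [y hy] [x hx] [z hz]; rewrite /D1_lt /=;
   move: y x z hy hx hz; do 4?[case=> //]; do 4?[case=> //]; do 4?[case=> //].
Qed.

HB.instance Definition _ :=
  Order.Lt_isPOrder.Build diamond_display D1 D1_lt_irr D1_lt_trans.

(* Meant for n >= 1; [diamond 0] is a junk value. *)
Definition diamond (n : nat) : finPOrderType diamond_display :=
  iter n.-1 (fun P => osum (remove_max P) D1 : finPOrderType diamond_display) D1.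

Section Chains.
Context {d : Order.disp_t} (P : finPOrderType d).

Definition covers (x y : P) : bool :=
  (x < y)%O && [forall z : P, ~~ ((x < z)%O && (z < y)%O)].

Definition edge : Type := {e : P * P | covers e.1 e.2}.

HB.instance Definition _ := Finite.on edge.
HB.instance Definition _ := SubChoice.on edge.

Definition saturated_chain (s : seq P) : bool := sorted covers s.

Definition maximal_saturated_chain (s : seq P) : Prop :=
  saturated_chain s /\
  forall t : seq P, saturated_chain t -> {subset s <= t} -> t = s.

Definition edge_in_chain (s : seq P) (e : edge) : bool :=
  val e \in zip s (behead s).

End Chains.

Section CardDiamond.

Lemma D1_ltE (x y : D1) : (x < y)%O = D1_lt x y.
Proof. by []. Qed.

Lemma D1_covers (x y : D1) :
  covers x y = ((val x, val y) \in [:: (0, 1); (0, 2); (1, 3); (2, 3)]%N).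
Proof.
apply/andP/idP => [[]|].
  rewrite D1_ltE /D1_lt !inE => /or4P[-> //|/eqP->//|/eqP->//|/orP[/eqP->//|]].
  case/eqP=> x0 y3 /forallP/(_ (Ordinal (isT : (1 < 4)%N))).
  by rewrite !D1_ltE /D1_lt /= x0 y3.
move=> xy; split.
  by rewrite D1_ltE /D1_lt; move: xy; rewrite !inE;
     case/or4P=> /eqP->.
apply/forallP=> [[z hz]]; rewrite !D1_ltE /D1_lt /=.
by move: xy; rewrite !inE; case/or4P=> /eqP[-> ->]; move: hz; do 4?[case: z => [|z] //].
Qed.

Lemma osum_ltE d (P Q : finPOrderType d) (u v : osum P Q) :
  (u < v)%O = osum_lt u v.
Proof. by []. Qed.

Definition D1max : D1 := Ordinal (isT : (3 < 4)%N).
Definition D1min : D1 := Ordinal (isT : (0 < 4)%N).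

Lemma D1_le_max (x : D1) : (x <= D1max)%O.
Proof.
rewrite le_eqVlt D1_ltE /D1_lt.
by case: x => x hx; rewrite -val_eqE /=; move: x hx; do 4?[case=> //].
Qed.

Lemma D1_ge_min (x : D1) : (D1min <= x)%O.
Proof.
rewrite le_eqVlt D1_ltE /D1_lt.
by case: x => x hx; rewrite -val_eqE /=; move: x hx; do 4?[case=> //].
Qed.

Lemma diamond1 : diamond 1 = D1.
Proof. by []. Qed.

Lemma diamondS n : diamond n.+2 = osum (remove_max (diamond n.+1)) D1.
Proof. by []. Qed.

Lemma diamond_max n : {m : diamond n | is_maximum m}.
Proof.
case: n => [|[|n]]; try by exists D1max; apply/forallP=> x; apply: D1_le_max.
rewrite diamondS; exists (inr D1max); apply/forallP=> u.
rewrite le_eqVlt osum_ltE; case: u => [//|u] /=.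
by have := D1_le_max u; rewrite le_eqVlt => /orP[/eqP->|->]; rewrite ?eqxx ?orbT.
Qed.

Lemma is_maximumE d (P : finPOrderType d) (m x : P) :
  is_maximum m -> is_maximum x = (x == m).
Proof.
move=> mm; apply/idP/eqP => [mx|->//]; apply/le_anti.
by rewrite (forallP mm) (forallP mx).
Qed.

Section CardStep.
Context {d : Order.disp_t} (P : finPOrderType d).
Context (Q : finPOrderType d) (b : Q) (bmin : forall y, (b <= y)%O).
Context (m : P) (mm : is_maximum m).

Lemma card_remove_max : #|{: remove_max P}|.+1 = #|P|.
Proof.
rewrite card_sig -(cardC (pred1 m)) card1 add1n; congr _.+1.
by apply: eq_card => x; rewrite !inE (is_maximumE _ mm).
Qed.

Let S := osum (remove_max P) Q.

Let g (x : P) : S :=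
  if insub x : option (remove_max P) is Some u then inl u else inr b.

Let g_lt x y : (g x < g y)%O = (x < y)%O.
Proof.
rewrite osum_ltE /g.
case: insubP => [u _ <-|]; case: insubP => [v nv <-|] //=;
  rewrite !negbK !(is_maximumE _ mm).
- move/eqP=> ->; rewrite lt_neqAle (forallP mm) andbT.
  by have := valP u; rewrite /= (is_maximumE _ mm) => ->.
- by move/eqP=> ->; rewrite le_gtF // (forallP mm).
by move=> /eqP-> /eqP->; rewrite !ltxx.
Qed.

Let g_inj : injective g.
Proof.
move=> x y; rewrite /g.
case: insubP => [u _ <-|]; case: insubP => [v nv <-|] //=; first by case=> ->.
by rewrite !negbK !(is_maximumE _ mm) => /eqP-> /eqP->.
Qed.

Let g_covers x y : covers (g x) (g y) = covers x y.
Proof.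
rewrite /covers g_lt; congr (_ && _).
apply/forallP/forallP=> [H z|H [u|w]]; first by have := H (g z); rewrite !g_lt.
  suff -> : inl u = g (val u) :> S by rewrite !g_lt.
  by rewrite /g valK.
rewrite !osum_ltE /g; case: insubP => [v _ _|_] /=; case: insubP => [v' _ _|_];
  rewrite ?andbF ?andbT //=.
  by rewrite le_gtF.
by rewrite [(w < b)%O]le_gtF // andbF.
Qed.

Let inr_covers (x y : Q) : @covers d S (inr x) (inr y) = covers x y.
Proof.
rewrite /covers osum_ltE /=; congr (_ && _).
apply/forallP/forallP=> [H z|H [u|w]]; first by have := H (inr z); rewrite !osum_ltE.
  by rewrite osum_ltE.
by have := H w; rewrite !osum_ltE.
Qed.

Lemma card_edge_step : #|{: edge S}| = (#|{: edge P}| + #|{: edge Q}|)%N.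
Proof.
pose gg (e : P * P) := (g e.1, g e.2).
pose ii (e : Q * Q) : S * S := (inr e.1, inr e.2).
rewrite !card_sig.
rewrite -[in RHS](card_imset _ (_ : injective gg)); last first.
  by case=> [x y] [x' y'] [/g_inj-> /g_inj->].
rewrite -[X in (_ + X)%N](card_imset _ (_ : injective ii)); last first.
  by case=> [x y] [x' y'] [-> ->].
rewrite -cardsUI [X in (_ + X)%N](_ : _ = 0%N) ?addn0; last first.
  apply: eq_card0 => e; rewrite !inE; apply/negP.
  case/andP=> /imsetP[[x y] cxy ->] /imsetP[[x' y'] _ []].
  move: cxy; rewrite inE /= -g_covers => /andP[lxy _] ex ey.
  move: lxy; rewrite ex ey; move: ex ey; rewrite /g.
  case: insubP => [? _ _ //|_] [<-]; case: insubP => [? _ _ //|_] [<-].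
  by rewrite osum_ltE /= ltxx.
apply: eq_card => [[u v]]; rewrite !inE.
apply/idP/orP=> [/= cuv|[]/imsetP[[x y]]]; last first.
- by rewrite inE /= -inr_covers => c [-> ->].
- by rewrite inE /= -g_covers => c [-> ->].
case: u v cuv => [u|x] [v|y] c; last first.
- by right; apply/imsetP; exists (x, y); rewrite // inE -inr_covers.
- by case/andP: c; rewrite osum_ltE.
- have yb : y = b.
    case/andP: c => _ /forallP/(_ (inr b)); rewrite !osum_ltE /=.
    by rewrite lt_neqAle bmin andbT negbK => /eqP.
  left; apply/imsetP; exists (val u, m).
    rewrite inE -g_covers /=.
    suff -> : g m = inr y by rewrite /g valK.
    by rewrite /g insubF ?yb // mm.
  rewrite /gg /= {1}/g valK; congr (_, _).
  by rewrite /g insubF ?yb // mm.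
left; apply/imsetP; exists (val u, val v).
  by rewrite inE -g_covers /g /= !valK.
by rewrite /gg /g /= !valK.
Qed.

End CardStep.

Lemma card_diamond n : (0 < n)%N -> #|diamond n| = (3 * n + 1)%N.
Proof.
case: n => // n _; elim: n => [|n IHn]; first exact: card_ord.
have [m mm] := diamond_max n.+1.
rewrite diamondS card_sum card_ord; move: IHn; rewrite -(card_remove_max mm).
by rewrite addn1 => -[->]; rewrite [in RHS]mulnSr -addnA.
Qed.

Lemma card_edge_D1 : #|{: @edge _ D1}| = 4.
Proof.
rewrite card_sig; pose o k hk : D1 := @Ordinal 4 k hk.
pose s := [:: (o 0 isT, o 1 isT); (o 0 isT, o 2 isT);
              (o 1 isT, o 3 isT); (o 2 isT, o 3 isT)].
have <- : #|s| = 4 by apply/card_uniqP.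
by apply: eq_card => [[x y]]; rewrite !inE /= D1_covers !inE.
Qed.

Lemma card_edge_diamond n : (0 < n)%N -> #|{: edge (diamond n)}| = (4 * n)%N.
Proof.
case: n => // n _; elim: n => [|n IHn]; first exact: card_edge_D1.
have [m mm] := diamond_max n.+1.
by rewrite diamondS (card_edge_step D1_ge_min mm) card_edge_D1 IHn [RHS]mulnSr.
Qed.

End CardDiamond.

Section BettiNumbers.
Context {k : fieldType} {N : nat}.
Local Notation S := {mpoly k[N]}.
Local Open Scope ring_scope.

Definition ideal_gen (G : S -> Prop) (p : S) : Prop :=
  exists s : seq (S * S),
    (forall x, x \in s -> G x.2) /\ p = \sum_(x <- s) x.1 * x.2.

Definition zhomog (z : int) (p : S) : Prop :=
  match z with
  | Posz e => p \is e.-homog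
  | Negz _ => p = 0
  end.

(* A sequence of graded free S-modules of finite rank
     ... -> F_2 -> F_1 -> F_0 -> S / I -> 0,   F_i = S^(rank i),
   where the basis vector a of F_i has degree gdeg i a.  Elements of F_i are
   row vectors and maps are v |-> v *m A; the augmentation F_0 -> S / I is
   given by a lift to S of the images of the basis vectors. *)
Record free_complex := FreeComplex {
  rank : nat -> nat;
  gdeg : forall i, 'I_(rank i) -> int;
  diff : forall i, 'M[S]_(rank i.+1, rank i);
  aug : 'cV[S]_(rank 0)
}.

Definition is_graded (F : free_complex) : Prop :=
  (forall a, zhomog (gdeg a) (aug F a 0)) /\
  (forall i a b, zhomog (gdeg a - gdeg b) (diff F i a b)).

Definition augment (F : free_complex) (v : 'rV[S]_(rank F 0)) : S :=
  (v *m aug F) 0 0.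

Definition is_resolution (I : S -> Prop) (F : free_complex) : Prop :=
  [/\ forall p : S, exists v, I (p - @augment F v),
      forall v, I (@augment F v) <-> exists w, v = w *m diff F 0
    & forall i (v : 'rV[S]_(rank F i.+1)),
        v *m diff F i = 0 <-> exists w, v = w *m diff F i.+1].

(* d(F_(i+1)) is contained in (X_1, ..., X_N) F_i. *)
Definition is_minimal (F : free_complex) : Prop :=
  forall i a b, (diff F i a b)@_0%MM = 0.

Definition minimal_graded_free_resolution (I : S -> Prop) (F : free_complex) :=
  [/\ is_graded F, is_resolution I F & is_minimal F].

(* beta_(i,j)(S / I): the number of basis elements of degree j in F_i, for a
   minimal graded free resolution F of S / I (all such F are isomorphic). *)
Definition betti (I : S -> Prop) (i : nat) (j : int) : nat :=
  epsilon (inhabits 0%N) (fun b => exists F,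
    minimal_graded_free_resolution I F /\
    b = #|[set a : 'I_(rank F i) | gdeg a == j]|).

Definition has_pure_resolution (I : S -> Prop) : Prop :=
  exists F, minimal_graded_free_resolution I F /\
    forall i, exists j : int, forall a : 'I_(rank F i), gdeg a = j.

End BettiNumbers.

Section Ideals.
Context (k : fieldType) {N : nat} {d : Order.disp_t} {P : finPOrderType d}.
Local Open Scope ring_scope.

(* [yv] numbers the edges of P by the variables of k[y_1, ..., y_N]. *)
Definition LD_ideal (yv : edge P -> 'I_N) : {mpoly k[N]} -> Prop :=
  ideal_gen (fun p => exists s : seq P, maximal_saturated_chain s /\
    p = \prod_(e : edge P | edge_in_chain s e) 'X_(yv e)).

(* [xv] numbers the elements of P by the variables of k[x_1, ..., x_N]. *)
Definition path_ideal (xv : P -> 'I_N) (t : nat) : {mpoly k[N]} -> Prop :=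
  ideal_gen (fun p => exists s : seq P, [/\ saturated_chain s, size s = t &
    p = \prod_(v <- s) 'X_(xv v)]).

End Ideals.

Arguments LD_ideal k {N d P} yv _.
Arguments path_ideal k {N d P} xv t _.

(* Main.v *)
(* Along its n diamonds a maximal chain makes n independent binary choices, so
   both ideals are of the form w * J_1 * ... * J_n with J_i = (u_i, v_i), where
   w and the u_i, v_i are monomials with pairwise disjoint supports (w = 1 for
   the edge ideal and w is the product of the bottlenecks for the path ideal).
   A product of ideals in disjoint sets of variables is resolved by the tensor
   product of the complexes S -> S^2 -> J_i; it is pure of linear growth, hence
   minimal, and its i-th rank is C(n, i) 2^(n - i).  Betti numbers can be read
   off this resolution because two minimal graded free resolutions are related
   by chain maps whose composites are homotopic to the identity; by minimality
   the homotopy terms vanish modulo the variables. *)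
Require Import Defs.
From HB Require Import structures.
From Stdlib Require Import ClassicalEpsilon FunctionalExtensionality PropExtensionality.
From mathcomp Require Import all_boot all_order all_algebra.
From mathcomp Require Import zify.
From mathcomp Require Import mpoly.

Set Implicit Arguments.
Unset Strict Implicit.
Unset Printing Implicit Defensive.

Import Order.TTheory GRing.Theory.

(** * Homogeneous components *)

Section GradedComponents.
Context {k : fieldType} {N : nat}.
Local Notation S := {mpoly k[N]}.
Local Open Scope ring_scope.
Implicit Types (z e : int) (p q : S).

(** Degrees are integers so that differences of basis degrees need no side condition; below zero
    only the zero polynomial is homogeneous. *)
Definition zcomp z p : S := if z is Posz d then pihomog mdeg d p else 0.

Lemma zhomog0 z : zhomog z (0 : S).
Proof. by case: z => //= d; apply: dhomog0. Qed.

Lemma zhomogM z e p q : zhomog z p -> zhomog e q -> zhomog (z + e) (p * q).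
Proof.
case: z e => [d|d] [e|e] /=; first exact: dhomogM.
- by move=> _ ->; rewrite mulr0; apply: zhomog0.
- by move=> -> _; rewrite mul0r; apply: zhomog0.
by move=> -> _; rewrite mul0r.
Qed.

Lemma zhomog_coeff0 z p : zhomog z p -> p@_0%MM != 0 -> z = 0.
Proof.
case: z => [d|d] /= hp; last by rewrite hp mcoeff0 eqxx.
by apply: contraNeq => nd; apply/eqP/(dhomog_nemf_coeff hp); rewrite /= mdeg0 eq_sym.
Qed.

Lemma zcompP z p : zhomog z (zcomp z p).
Proof. by case: z => //= d; apply: pihomogP. Qed.

Lemma zcomp_id z p : zhomog z p -> zcomp z p = p.
Proof. by case: z => [d|d] //=; apply: pihomog_dE. Qed.

Lemma zcomp_ne z e p : zhomog e p -> z != e -> zcomp z p = 0.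
Proof.
case: z e => [d|d] [e|e] //= hp; last by rewrite hp pihomog0.
by rewrite eqz_nat eq_sym => ne; apply: pihomog_ne0 hp.
Qed.

Lemma zcomp0 z : zcomp z 0 = 0.
Proof. by rewrite zcomp_id //; apply: zhomog0. Qed.

Lemma zcompD z p q : zcomp z (p + q) = zcomp z p + zcomp z q.
Proof. by case: z => [d|d] /=; rewrite ?pihomogD ?addr0. Qed.

Lemma zcompB z p q : zcomp z (p - q) = zcomp z p - zcomp z q.
Proof. by case: z => [d|d] /=; rewrite ?pihomogB ?subr0. Qed.

Lemma zcomp_sum (I : Type) (r : seq I) (P : pred I) z (F : I -> S) :
  zcomp z (\sum_(i <- r | P i) F i) = \sum_(i <- r | P i) zcomp z (F i).
Proof. exact: (big_morph _ (zcompD z) (zcomp0 z)). Qed.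

(** Split [p] into homogeneous components: multiplication by [q] sends the one of degree [z] to
    degree [z + e] and every other one to a different degree. *)
Lemma zcompM z e p q : zhomog e q -> zcomp (z + e) (p * q) = zcomp z p * q.
Proof.
move=> hq; rewrite (pihomog_partitionE (leqnn (mmeasure mdeg p))).
rewrite mulr_suml !zcomp_sum mulr_suml; apply: eq_bigr => d _.
set pd := pihomog _ _ _; have hpd : zhomog (Posz d) pd by apply: pihomogP.
have [->|nzd] := eqVneq z (Posz d).
  by rewrite !zcomp_id //; apply: zhomogM.
rewrite (zcomp_ne hpd nzd) mul0r; apply: zcomp_ne (zhomogM hpd hq) _.
by rewrite (inj_eq (addIr e)).
Qed.

Definition graded_mx m n (e : 'I_m -> int) (g : 'I_n -> int) (A : 'M[S]_(m, n)) :=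
  forall a b, zhomog (e a - g b) (A a b).

(** Entry [(a, b)] of a degree-preserving map has degree [e a - g b]. Keeping only this component
    turns an arbitrary lift into a graded one. *)
Definition graded_part m n (e : 'I_m -> int) (g : 'I_n -> int) (A : 'M[S]_(m, n))
  : 'M[S]_(m, n) := \matrix_(a, b) zcomp (e a - g b) (A a b).

Lemma graded_partP m n (e : 'I_m -> int) (g : 'I_n -> int) (A : 'M[S]_(m, n)) :
  graded_mx e g (graded_part e g A).
Proof. by move=> a b; rewrite mxE; apply: zcompP. Qed.

Lemma graded_part_id m n (e : 'I_m -> int) (g : 'I_n -> int) (A : 'M[S]_(m, n)) :
  graded_mx e g A -> graded_part e g A = A.
Proof. by move=> gA; apply/matrixP=> a b; rewrite mxE zcomp_id. Qed.

Lemma graded_partM m n l (e : 'I_m -> int) (g : 'I_n -> int) (h : 'I_l -> int)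
    (A : 'M[S]_(m, n)) (B : 'M[S]_(n, l)) :
  graded_mx g h B ->
  graded_part e h (A *m B) = graded_part e g A *m B.
Proof.
move=> gB; apply/matrixP=> a c; rewrite !mxE zcomp_sum.
apply: eq_bigr => b _; rewrite mxE -(zcompM _ _ (gB b c)); congr zcomp; lia.
Qed.

Lemma graded_mxM m n l (e : 'I_m -> int) (g : 'I_n -> int) (h : 'I_l -> int)
    (A : 'M[S]_(m, n)) (B : 'M[S]_(n, l)) :
  graded_mx e g A -> graded_mx g h B -> graded_mx e h (A *m B).
Proof.
(* The product equals its own graded part, hence is graded. *)
move=> gA gB; rewrite -(graded_part_id gA) -(graded_partM _ _ gB).
exact: graded_partP.
Qed.

Definition homogeneous_ideal (I : S -> Prop) : Prop :=
  [/\ I 0, forall p q, I p -> I q -> I (p + q), forall p q, I q -> I (p * q)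
    & forall z p, I p -> I (zcomp z p)].

Lemma ideal_gen_add (G : S -> Prop) p q :
  ideal_gen G p -> ideal_gen G q -> ideal_gen G (p + q).
Proof.
case=> s [Gs ->] [t [Gt ->]]; exists (s ++ t); split; last by rewrite big_cat.
by move=> x; rewrite mem_cat => /orP[/Gs|/Gt].
Qed.

Lemma ideal_gen0 (G : S -> Prop) : ideal_gen G 0.
Proof. by exists [::]; rewrite big_nil. Qed.

Lemma ideal_gen_mull (G : S -> Prop) p q : ideal_gen G q -> ideal_gen G (p * q).
Proof.
case=> s [Gs ->]; exists [seq (p * x.1, x.2) | x <- s]; split.
  by move=> _ /mapP[x /Gs Gx ->].
by rewrite big_map mulr_sumr; apply: eq_bigr => x _; rewrite mulrA.
Qed.

Lemma ideal_gen_gen (G : S -> Prop) p : G p -> ideal_gen G p.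
Proof.
move=> Gp; exists [:: (1, p)]; split; last by rewrite big_seq1 mul1r.
by move=> x; rewrite inE => /eqP->.
Qed.

Lemma ideal_gen_ind (G P : S -> Prop) :
  P 0 -> (forall p q, P p -> P q -> P (p + q)) ->
  (forall p q, G q -> P (p * q)) -> forall p, ideal_gen G p -> P p.
Proof.
move=> P0 PD PG p [s [Gs ->]]; rewrite big_seq.
by elim/big_ind: _ => // x /Gs; apply: PG.
Qed.

Lemma homogeneous_ideal_gen (G : S -> Prop) :
  (forall p, G p -> exists d, p \is d.-homog) -> homogeneous_ideal (ideal_gen G).
Proof.
move=> hG; split; [exact: ideal_gen0|exact: ideal_gen_add|exact: ideal_gen_mull|].
move=> z; apply: ideal_gen_ind => [|p q Ip Iq|p q Gq].
- by rewrite zcomp0; apply: ideal_gen0.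
- by rewrite zcompD; apply: ideal_gen_add.
have [d hq] := hG q Gq; rewrite -(subrK (Posz d) z) (@zcompM _ (Posz d) _ _ hq).
exact/ideal_gen_mull/ideal_gen_gen.
Qed.

End GradedComponents.

(** * Uniqueness of graded Betti numbers *)

Section Uniqueness.
Context {k : fieldType} {N : nat}.
Local Notation S := {mpoly k[N]}.
Local Open Scope ring_scope.
Local Notation const_mx0 := (map_mx (mcoeff (0%MM : 'X_{1..N}))).

(** In degree 0 the augmentation need only land in [I], since it stands for a map to [S / I]. This
    makes exactness one statement for all [i]. *)
Definition cycle (I : S -> Prop) (F : @free_complex k N) (i : nat) :
    'rV[S]_(rank F i) -> Prop :=
  match i return 'rV[S]_(rank F i) -> Prop with
  | 0 => fun v => I (augment v)
  | j.+1 => fun v => v *m diff F j = 0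
  end.

Lemma cycleP I F i (v : 'rV[S]_(rank F i)) : is_resolution I F ->
  cycle I v <-> exists w, v = w *m diff F i.
Proof. by case: i v => [|i] v [_ h0 h]; [apply: h0|apply: h]. Qed.

Lemma cycle_diff I F i (w : 'rV[S]_(rank F i.+1)) : is_resolution I F ->
  cycle I (w *m diff F i).
Proof. by move=> rF; apply/(cycleP _ rF); exists w. Qed.

Lemma cycle_row I F i a : is_resolution I F -> cycle I (row a (diff F i)).
Proof. by move=> rF; rewrite rowE; apply: cycle_diff. Qed.

Lemma lift_cycles I F i m (A : 'M[S]_(m, rank F i)) : is_resolution I F ->
  (forall a, cycle I (row a A)) -> exists W, A = W *m diff F i.
Proof.
move=> rF cA; have /fin_all_exists[w hw] a := (cycleP _ rF).1 (cA a).
exists (\matrix_a w a); apply/row_matrixP=> a.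
by rewrite hw row_mul rowK.
Qed.

(** Exactness lifts [A] row by row. Replacing the lift by its graded part keeps the equation,
    because [A] and the differential are graded. *)
Lemma lift_graded_cycles I F i m (e : 'I_m -> int) (A : 'M[S]_(m, rank F i)) :
  is_graded F -> is_resolution I F -> graded_mx e (@gdeg _ _ F i) A ->
  (forall a, cycle I (row a A)) ->
  exists2 W, graded_mx e (@gdeg _ _ F i.+1) W & A = W *m diff F i.
Proof.
move=> gF rF gA cA; have [W AW] := lift_cycles rF cA.
exists (graded_part e (@gdeg _ _ F i.+1) W); first exact: graded_partP.
have gd : graded_mx (@gdeg _ _ F i.+1) (@gdeg _ _ F i) (diff F i) by exact: gF.2.
by rewrite -(graded_part_id gA) AW (graded_partM _ _ gd).
Qed.

(* [f] and [g] are the degree-[i] components of chain maps [F -> G -> F] lifting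
   the identity of [S / I], and [h] the component [F_i -> F_(i+1)] of a homotopy
   between [f g] and the identity. *)
Definition left_inverse_mod_homotopy I (F G : @free_complex k N) i
    (f : 'M[S]_(rank F i, rank G i)) (g : 'M[S]_(rank G i, rank F i)) : Prop :=
  [/\ graded_mx (@gdeg _ _ F i) (@gdeg _ _ G i) f,
      forall v, cycle I v -> cycle I (v *m f),
      exists h, forall v, cycle I v -> v *m f *m g = v + v *m h *m diff F i
    & const_mx0 (f *m g) = 1%:M].

Lemma const_diff0 F i : @is_minimal k N F -> const_mx0 (diff F i) = 0.
Proof. by move=> mF; apply/matrixP=> a b; rewrite !mxE; apply: mF. Qed.

Lemma chain_map_step I F G i (f : 'M[S]_(rank F i, rank G i)) :
  minimal_graded_free_resolution I F -> minimal_graded_free_resolution I G ->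
  graded_mx (@gdeg _ _ F i) (@gdeg _ _ G i) f ->
  (forall v, cycle I v -> cycle I (v *m f)) ->
  exists2 f', graded_mx (@gdeg _ _ F i.+1) (@gdeg _ _ G i.+1) f'
    & diff F i *m f = f' *m diff G i.
Proof.
move=> [gF rF _] [gG rG _] gf cf; apply: (lift_graded_cycles gG rG).
  by apply: graded_mxM gf; apply: gF.2.
by move=> a; rewrite row_mul; apply/cf/cycle_row.
Qed.

(** The usual construction of a homotopy: [f' *m g' - 1 - diff F i *m h] has cycles as rows, hence
    equals [h' *m diff F i.+1]. The term in [h] dies on cycles, and by minimality both terms have
    zero constant part. *)
Lemma left_inverse_step I F G i (f : 'M[S]_(rank F i, rank G i)) g f' g' :
  minimal_graded_free_resolution I F -> minimal_graded_free_resolution I G ->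
  left_inverse_mod_homotopy I f g ->
  graded_mx (@gdeg _ _ F i.+1) (@gdeg _ _ G i.+1) f' ->
  diff F i *m f = f' *m diff G i -> diff G i *m g = g' *m diff F i ->
  left_inverse_mod_homotopy I f' g'.
Proof.
move=> [gF rF mF] [gG rG mG] [_ cf [h hh] _] gf' df dg.
have dfg : diff F i *m f *m g = diff F i + diff F i *m h *m diff F i.
  apply/row_matrixP=> a; rewrite !row_mul hh; last exact: cycle_row.
  by rewrite -!row_mul -linearD.
have [|h' hh'] := @lift_cycles I F i.+1 _ (f' *m g' - 1%:M - diff F i *m h) rF.
  move=> a /=; rewrite -row_mul !mulmxBl -(mulmxA f') -dg mulmxA -df dfg mul1mx.
  by rewrite [X in row a (X - _ - _)]addrC addrK subrr linear0.
have fg : f' *m g' = 1%:M + diff F i *m h + h' *m diff F i.+1.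
  by rewrite -hh' addrC -[_ - 1%:M - _]addrA -opprD subrK.
split=> // [v /= cv||].
- by rewrite -mulmxA -df mulmxA cv mul0mx.
- exists h' => v /= cv.
  by rewrite -mulmxA fg !mulmxDr mulmx1 !mulmxA cv mul0mx addr0.
by rewrite fg !map_mxD !map_mxM !const_diff0 // mul0mx mulmx0 !addr0 map_mx1.
Qed.

Lemma ideal_mulmx I m (v : 'rV[S]_m) (A : 'cV[S]_m) : homogeneous_ideal I ->
  (forall a, I (A a 0)) -> I ((v *m A) 0 0).
Proof.
by case=> I0 ID IM _ IA; rewrite mxE; elim/big_ind: _ => // a _; apply: IM.
Qed.

(** Surjectivity of [G] onto [S / I] gives a lift modulo [I]; its graded part is still one because
    [I] contains the homogeneous components of its elements. *)
Lemma augmentation_lift I (F G : @free_complex k N) : homogeneous_ideal I ->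
  is_graded F -> is_graded G -> is_resolution I G ->
  exists2 f, graded_mx (@gdeg _ _ F 0) (@gdeg _ _ G 0) f
    & forall a, I ((aug F - f *m aug G) a 0).
Proof.
move=> [_ _ _ Iz] [gF _] [gG _] [eG _ _].
have /fin_all_exists[w hw] a := eG (aug F a 0).
pose f := \matrix_a w a.
(* The basis vector of [S] has degree 0, so an augmentation is a graded matrix with one column. *)
pose z := fun _ : 'I_1 => 0 : int.
have gaG : graded_mx (@gdeg _ _ G 0) z (aug G).
  by move=> a b; rewrite (ord1 b) subr0; apply: gG.
have gaF : graded_mx (@gdeg _ _ F 0) z (aug F).
  by move=> a b; rewrite (ord1 b) subr0; apply: gF.
exists (graded_part (@gdeg _ _ F 0) (@gdeg _ _ G 0) f); first exact: graded_partP.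
move=> a; rewrite -(graded_partM _ _ gaG) -(graded_part_id gaF).
rewrite !mxE -zcompB; apply: Iz; have := hw a.
rewrite /augment -(rowK w a) -/f -row_mul.
by rewrite [X in aug F a 0 - X]mxE !mxE.
Qed.

(** Since [f] and [g] respect the augmentations modulo [I], the rows of [f *m g - 1] are cycles of
    degree 0, hence boundaries. *)
Lemma left_inverse_base I F G (f : 'M[S]_(rank F 0, rank G 0)) g :
  homogeneous_ideal I -> minimal_graded_free_resolution I F ->
  graded_mx (@gdeg _ _ F 0) (@gdeg _ _ G 0) f ->
  (forall a, I ((aug F - f *m aug G) a 0)) ->
  (forall a, I ((aug G - g *m aug F) a 0)) ->
  left_inverse_mod_homotopy I f g.
Proof.
move=> hI [gF rF mF] gf ff gg; have [I0 ID IM _] := hI.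
have IN p : I p -> I (- p) by rewrite -mulN1r; apply: IM.
have [|h hh] := @lift_cycles I F 0 _ (f *m g - 1%:M) rF.
  move=> a; rewrite /= /augment -row_mul mulmxBl mul1mx -mulmxA.
  have -> : f *m (g *m aug F) - aug F
      = - (f *m (aug G - g *m aug F)) - (aug F - f *m aug G).
    by rewrite mulmxBr opprB opprB addrA subrK.
  rewrite linearB linearN /= mxE; apply: ID; rewrite mxE; apply: IN.
    by rewrite row_mul; apply: ideal_mulmx.
  by rewrite mxE.
have fg : f *m g = 1%:M + h *m diff F 0 by rewrite -hh addrC subrK.
split=> // [v /= cv||].
- have -> : augment (v *m f) = augment v - (v *m (aug F - f *m aug G)) 0 0.
    have mxB (p q : 'M[S]_1) : (p - q) 0 0 = p 0 0 - q 0 0 by rewrite !mxE.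
    by rewrite /augment mulmxBr mulmxA mxB opprB addrC subrK.
  by apply: ID => //; apply: IN; apply: ideal_mulmx.
- by exists h => v _; rewrite -mulmxA fg mulmxDr mulmx1 mulmxA.
by rewrite fg map_mxD map_mxM const_diff0 // mulmx0 addr0 map_mx1.
Qed.

Lemma resolution_comparison I F G i : homogeneous_ideal I ->
  minimal_graded_free_resolution I F -> minimal_graded_free_resolution I G ->
  exists (f : 'M[S]_(rank F i, rank G i)) (g : 'M[S]_(rank G i, rank F i)),
    left_inverse_mod_homotopy I f g /\ left_inverse_mod_homotopy I g f.
Proof.
move=> hI hF hG; elim: i => [|i [f [g [fg gf]]]].
  have [[gF rF _] [gG rG _]] := (hF, hG).
  have [f gf ff] := augmentation_lift hI gF gG rG.
  have [g gg ggg] := augmentation_lift hI gG gF rF.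
  by exists f, g; split; apply: left_inverse_base.
have [[f_graded cf _ _] [g_graded cg _ _]] := (fg, gf).
have [f' gf' df] := chain_map_step hF hG f_graded cf.
have [g' gg' dg] := chain_map_step hG hF g_graded cg.
by exists f', g'; split; [apply: left_inverse_step fg _ _ _
                         |apply: left_inverse_step gf _ _ _].
Qed.

(** * Counting basis elements degree by degree *)

(** Entries of [A] between different degrees vanish, so restricting both matrices to degree [j]
    keeps the product equal to the identity, and the sizes compare as ranks. *)
Lemma leq_card_degree (K : fieldType) m n (A : 'M[K]_(m, n)) (B : 'M[K]_(n, m))
    (e : 'I_m -> int) (g : 'I_n -> int) (j : int) :
  A *m B = 1%:M -> (forall a b, A a b != 0 -> e a = g b) ->
  (#|[set a | e a == j]| <= #|[set b | g b == j]|)%N.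
Proof.
move=> AB hA.
pose U := [set a | e a == j]; pose V := [set b | g b == j].
pose A' := \matrix_(x < #|U|, y < #|V|) A (enum_val x) (enum_val y).
pose B' := \matrix_(y < #|V|, x < #|U|) B (enum_val y) (enum_val x).
apply: (@mulmx1_min _ _ _ A' B'); apply/matrixP=> x x'; rewrite !mxE.
under eq_bigr do rewrite !mxE.
rewrite -(big_enum_val (I := 'I_n) (A := mem V)
  (fun b => A (enum_val x) b * B b (enum_val x'))).
have /matrixP/(_ (enum_val x) (enum_val x')) := AB.
rewrite !mxE (inj_eq enum_val_inj) => <-; rewrite big_mkcond /=.
apply: eq_bigr => b _; case: ifP => //; apply: contraFeq => /eqP AB0.
rewrite inE -(hA (enum_val x) b); last by apply: contra_not_neq AB0 => ->; rewrite mul0r.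
by have := enum_valP x; rewrite inE.
Qed.

(** The constant parts of the comparison maps are matrices over [k]. A homogeneous entry with
    nonzero constant term has degree 0, so it joins basis vectors of equal degree. *)
Lemma leq_card_gdeg I (F G : @free_complex k N) i (j : int) : homogeneous_ideal I ->
  minimal_graded_free_resolution I F -> minimal_graded_free_resolution I G ->
  (#|[set a : 'I_(rank F i) | gdeg a == j]| <=
   #|[set a : 'I_(rank G i) | gdeg a == j]|)%N.
Proof.
move=> hI hF hG; have [f [g [[gf _ _ fg] _]]] := resolution_comparison i hI hF hG.
rewrite map_mxM in fg; apply: leq_card_degree fg _ => a b; rewrite mxE.
by move/(zhomog_coeff0 (gf a b))/eqP; rewrite subr_eq0 => /eqP.
Qed.

Theorem bettiE I (F : @free_complex k N) i (j : int) : homogeneous_ideal I ->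
  minimal_graded_free_resolution I F ->
  betti I i j = #|[set a : 'I_(rank F i) | gdeg a == j]|.
Proof.
move=> hI hF; rewrite /betti; set P := fun b : nat => _.
(* [epsilon] counts in some unknown minimal resolution [G]; two inequalities identify that count
   with the one in [F]. *)
have [|G [hG ->]] := epsilon_spec (inhabits 0%N) P; first by eexists; exists F.
by apply/eqP; rewrite eqn_leq (leq_card_gdeg _ _ hI hG hF) (leq_card_gdeg _ _ hI hF hG).
Qed.

End Uniqueness.

(** * Resolution of a product of ideals *)

Section Cone.
Context {k : fieldType} {N : nat}.
Local Notation S := {mpoly k[N]}.
Local Open Scope ring_scope.
Implicit Types (J : S -> Prop) (F : @free_complex k N).

(* Unlike in [is_resolution], [F] resolves the ideal [J] itself, not [S / J]. *)
Definition resolves_ideal J F : Prop :=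
  [/\ forall p, J p <-> exists v, p = @augment _ _ F v,
      forall v, @augment _ _ F v = 0 <-> exists w, v = w *m diff F 0
    & forall i (v : 'rV[S]_(rank F i.+1)),
        v *m diff F i = 0 <-> exists w, v = w *m diff F i.+1].

Definition pred_rank (r : nat -> nat) (i : nat) : nat := if i is j.+1 then r j else 0%N.

Definition prev_diff F i : 'M[S]_(rank F i, pred_rank (rank F) i) :=
  match i with 0 => 0 | j.+1 => diff F j end.

Definition cone_rank (r : nat -> nat) (i : nat) : nat := (r i + r i + pred_rank r i)%N.

(** The blocks correspond to two copies of [F] and one copy shifted by one. The sign on the shifted
    differential makes consecutive maps compose to zero. *)
Definition cone_diff (u v : S) F i :
    'M[S]_(cone_rank (rank F) i.+1, cone_rank (rank F) i) :=
  block_mx (block_mx (diff F i) 0 0 (diff F i)) 0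
           (row_mx v%:M (- u)%:M) (- prev_diff F i).

(* The tensor product of [F] with the complex [(v, -u) : S -> S^2], whose
   augmentation is [(u, v) : S^2 -> S]; all degrees of its [i]-th term are
   declared to be [e + d * i]. *)
Definition cone (e d : nat) (u v : S) F : free_complex :=
  @FreeComplex k N (cone_rank (rank F)) (fun i _ => Posz (e + d * i))
    (cone_diff u v F)
    (col_mx (col_mx (u *: aug F) (v *: aug F)) 0).

Lemma row_mx3K m n l (x : 'rV[S]_(m + n + l)) :
  exists a b c, x = row_mx (row_mx a b) c.
Proof.
exists (lsubmx (lsubmx x)), (rsubmx (lsubmx x)), (rsubmx x).
by rewrite !hsubmxK.
Qed.

Lemma mul_cone_diff (u v : S) F i (a b : 'rV[S]_(rank F i.+1)) (c : 'rV[S]_(rank F i)) :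
  row_mx (row_mx a b) c *m cone_diff u v F i =
  row_mx (row_mx (a *m diff F i + v *: c) (b *m diff F i - u *: c))
         (- (c *m prev_diff F i)).
Proof.
rewrite /cone_diff mul_row_block mul_row_block mul_mx_row !mul_mx_scalar.
by rewrite !mulmx0 add0r addr0 add_row_mx add0r mulmxN scaleNr.
Qed.

Lemma augment_cone e d (u v : S) F (a b : 'rV[S]_(rank F 0)) c :
  @augment _ _ (cone e d u v F) (row_mx (row_mx a b) c) = u * augment a + v * augment b.
Proof.
rewrite /augment /= mul_row_col mulmx0 addr0 mul_row_col -!scalemxAr.
by rewrite mxE [X in X + _]mxE [X in _ + X]mxE.
Qed.

Lemma augmentB F (a b : 'rV[S]_(rank F 0)) : augment (a - b) = augment a - augment b.
Proof. by rewrite /augment mulmxBl !mxE. Qed.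

Lemma augmentD F (a b : 'rV[S]_(rank F 0)) : augment (a + b) = augment a + augment b.
Proof. by rewrite /augment mulmxDl mxE. Qed.

Lemma augmentZ F (t : S) (a : 'rV[S]_(rank F 0)) : augment (t *: a) = t * augment a.
Proof. by rewrite /augment -scalemxAl mxE. Qed.

Lemma row_mx0_inj m n (a : 'rV[S]_m) (b : 'rV[S]_n) :
  row_mx a b = 0 -> a = 0 /\ b = 0.
Proof. by rewrite -row_mx0 => /eq_row_mx. Qed.

(** The last hypothesis says that the syzygies of [(u, v)] with coefficients in [J] are the
    multiples of [(v, -u)] by [J]; this is exactness at the bottom. Higher up, correcting by a lift
    of the shifted component reduces to exactness of [F]. *)
Lemma cone_resolves J F e d (u v : S) : v != 0 -> resolves_ideal J F ->
  (forall p q, J p -> J q -> u * p + v * q = 0 ->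
     exists t, [/\ J t, p = v * t & q = - u * t]) ->
  resolves_ideal (fun p => exists q r, [/\ J q, J r & p = u * q + v * r])
    (cone e d u v F).
Proof.
move=> v0 [hJ h0 h1] reg.
have ad (w : 'rV[S]_(rank F 1)) : augment (w *m diff F 0) = 0 by apply/h0; exists w.
have dd i (w : 'rV[S]_(rank F i.+2)) : w *m diff F i.+1 *m diff F i = 0.
  by apply/h1; exists w.
have dp i (w : 'rV[S]_(rank F i.+1)) : w *m diff F i *m prev_diff F i = 0.
  by case: i w => [|i] w /=; rewrite ?mulmx0 ?dd.
split=> [p|x|i x].
- split=> [[q [r [/hJ[a ->] /hJ[b ->] ->]]]|[x ->]].
    by exists (row_mx (row_mx a b) 0); rewrite augment_cone.
  have [a [b [c ->]]] := row_mx3K x; rewrite augment_cone.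
  by exists (augment a), (augment b); split=> //; apply/hJ; eexists.
- split=> [|[y ->]].
    have [a [b [c ->]]] := row_mx3K x; rewrite augment_cone => ab.
    have [||t [/hJ[c' ->] ac bc]] := reg _ _ _ _ ab; try by apply/hJ; eexists.
    have /h0[a' ha] : augment (a - v *: c') = 0 by rewrite augmentB augmentZ ac subrr.
    have /h0[b' hb] : augment (b - (- u) *: c') = 0.
      by rewrite augmentB augmentZ bc subrr.
    exists (row_mx (row_mx a' b') c'); rewrite mul_cone_diff -ha -hb.
    by rewrite scaleNr opprK addrK subrK; congr row_mx; apply/matrixP=> ? [].
  have [a [b [c ->]]] := row_mx3K y; rewrite mul_cone_diff augment_cone.
  by rewrite augmentB augmentD !augmentZ !ad add0r sub0r mulrN mulrCA subrr.
split=> [|[y ->]]; last first.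
  have [a [b [c ->]]] := row_mx3K y; rewrite /= !mul_cone_diff /=.
  rewrite mulmxDl mulmxBl -!scalemxAl !dd sub0r add0r !scalerN subrr opprK addNr.
  by rewrite mulNmx dp !oppr0 !row_mx0.
have [a [b [c ->]]] := row_mx3K x; rewrite /= mul_cone_diff.
move=> /row_mx0_inj[/row_mx0_inj[ha hb] /eqP]; rewrite oppr_eq0 => /eqP hc.
(* For [i = 0] the previous differential is zero and [hc] is empty; instead, augmenting [ha] gives
   [v * augment c = 0], and [v] is nonzero in a domain. *)
have [c' cc'] : exists c', c = c' *m diff F i.
  case: i a b c ha hb hc {x} => [|i] a b c ha hb hc; last exact/h1.
  apply/h0; have := congr1 (@augment _ _ F) ha.
  rewrite augmentD ad add0r augmentZ /augment mul0mx [RHS]mxE => /eqP.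
  by rewrite mulf_eq0 (negPf v0) => /eqP.
have /h1[a' ha'] : (a + v *: c') *m diff F i = 0.
  by rewrite mulmxDl -scalemxAl -cc'.
have /h1[b' hb'] : (b - u *: c') *m diff F i = 0.
  by rewrite mulmxBl -scalemxAl -cc'.
(* The sign of [c'] compensates the one on the shifted differential, and its images under [v] and
   [-u] undo the corrections of [a] and [b]. *)
exists (row_mx (row_mx a' b') (- c')); rewrite mul_cone_diff -ha' -hb' /=.
by rewrite mulNmx opprK -cc' !scalerN addrK opprK subrK.
Qed.

End Cone.

(** * Degrees, ranks and minimality of the product complex *)

Section Grading.
Context {k : fieldType} {N : nat}.
Local Notation S := {mpoly k[N]}.
Local Open Scope ring_scope.
Implicit Types (J : S -> Prop) (F : @free_complex k N).


Definition homog_mx d m n (A : 'M[S]_(m, n)) := forall a b, A a b \is d.-homog.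

Lemma homog_mx0 d m n : homog_mx d (0 : 'M[S]_(m, n)).
Proof. by move=> a b; rewrite mxE dhomog0. Qed.

Lemma homog_mxN d m n (A : 'M[S]_(m, n)) : homog_mx d A -> homog_mx d (- A).
Proof. by move=> hA a b; rewrite mxE dhomogN. Qed.

Lemma homog_scalar_mx d m (p : S) : p \is d.-homog -> homog_mx d (p%:M : 'M_m).
Proof. by move=> hp a b; rewrite mxE; case: eqP => // _; apply: dhomog0. Qed.

Lemma homog_row_mx d m n l (A : 'M[S]_(m, n)) (B : 'M[S]_(m, l)) :
  homog_mx d A -> homog_mx d B -> homog_mx d (row_mx A B).
Proof. by move=> hA hB a b; rewrite mxE; case: split. Qed.

Lemma homog_col_mx d m n l (A : 'M[S]_(m, n)) (B : 'M[S]_(l, n)) :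
  homog_mx d A -> homog_mx d B -> homog_mx d (col_mx A B).
Proof. by move=> hA hB a b; rewrite mxE; case: split. Qed.

Lemma homog_block_mx d m1 m2 n1 n2 (A : 'M[S]_(m1, n1)) (B : 'M[S]_(m1, n2))
    (C : 'M[S]_(m2, n1)) (D : 'M[S]_(m2, n2)) :
  homog_mx d A -> homog_mx d B -> homog_mx d C -> homog_mx d D ->
  homog_mx d (block_mx A B C D).
Proof. by move=> hA hB hC hD; apply/homog_col_mx; apply/homog_row_mx. Qed.

Lemma homog_scale_mx d e m n (p : S) (A : 'M[S]_(m, n)) :
  p \is d.-homog -> homog_mx e A -> homog_mx (d + e) (p *: A).
Proof. by move=> hp hA a b; rewrite mxE; apply: dhomogM. Qed.

Definition pure_graded (e d : nat) F : Prop :=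
  [/\ forall i (a : 'I_(rank F i)), gdeg a = Posz (e + d * i),
      homog_mx e (aug F) & forall i, homog_mx d (diff F i)].

Lemma cone_pure e d (u v : S) F : u \is d.-homog -> v \is d.-homog ->
  pure_graded e d F -> pure_graded (d + e) d (cone (d + e) d u v F).
Proof.
move=> hu hv [_ ha hd]; split=> // [|i].
  by apply: homog_col_mx; [apply: homog_col_mx; apply: homog_scale_mx|apply: homog_mx0].
have hprev : homog_mx d (prev_diff F i) by case: i => [|i]; [apply: homog_mx0|apply: hd].
apply: homog_block_mx; last exact: homog_mxN.
- by apply: homog_block_mx => //; apply: homog_mx0.
- exact: homog_mx0.
by apply: homog_row_mx; apply: homog_scalar_mx; rewrite ?dhomogN.
Qed.

Definition principal_complex (e d : nat) (w : S) : free_complex :=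
  @FreeComplex k N (fun i => (i == 0)%N : nat) (fun i _ => Posz (e + d * i))
    (fun=> 0) (const_mx w).

Lemma principal_resolves e d (w : S) : w != 0 ->
  resolves_ideal (fun p => exists q, p = q * w) (principal_complex e d w).
Proof.
move=> w0.
have augE (x : 'rV_1) : @augment _ _ (principal_complex e d w) x = x 0 0 * w.
  by rewrite /augment mxE big_ord1 mxE.
split=> [p|x|i x].
- split=> [[q ->]|[x ->]]; last by exists (x 0 0); rewrite augE.
  by exists (const_mx q); rewrite augE mxE.
- rewrite augE; split=> [/eqP|[y ->]]; last by rewrite mulmx0 mxE mul0r.
  rewrite mulf_eq0 (negPf w0) orbF => /eqP x0; exists 0.
  by rewrite mul0mx; apply/matrixP=> a b; rewrite !ord1 x0 mxE.
by split=> _; [exists 0; apply/matrixP=> ? []|rewrite mulmx0].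
Qed.

Lemma principal_pure e d (w : S) : w \is e.-homog ->
  pure_graded e d (principal_complex e d w).
Proof.
by move=> hw; split=> //= [a b|i]; [rewrite mxE|apply: homog_mx0].
Qed.

Fixpoint product_complex (e d : nat) (w : S) (u v : nat -> S) (m : nat) : free_complex :=
  if m is l.+1 then
    cone (d * m + e) d (u l) (v l) (product_complex e d w u v l)
  else principal_complex e d w.

Lemma product_pure e d (w : S) (u v : nat -> S) m : w \is e.-homog ->
  (forall i, (i < m)%N -> u i \is d.-homog) ->
  (forall i, (i < m)%N -> v i \is d.-homog) ->
  pure_graded (d * m + e) d (product_complex e d w u v m).
Proof.
move=> hw; elim: m => [|m IHm] hu hv /=; first by rewrite muln0; apply: principal_pure.
rewrite mulnS -addnA; apply: cone_pure; [exact: hu|exact: hv|].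
by apply: IHm => i im; [apply: hu|apply: hv]; apply: ltnW.
Qed.

Lemma rank_product e d (w : S) (u v : nat -> S) m i :
  rank (product_complex e d w u v m) i = ('C(m, i) * 2 ^ (m - i))%N.
Proof.
elim: m i => [|m IHm] i /=; first by case: i.
rewrite /cone_rank addnn -mul2n; case: i => [|i] /=.
  by rewrite IHm !bin0 !subn0 expnS mulnCA addn0.
(* Pascal's rule for the recursion [2 * r i.+1 + r i]. For [m <= i] the exponent [m - i.+1] is
   truncated, but there ['C(m, i.+1)] vanishes. *)
rewrite !IHm binS subSS mulnDl; have [im|mi] := ltnP i m.
  by rewrite -(subnSK im) expnS mulnCA.
by rewrite (bin_small (_ : m < i.+1)%N) // !mul0n !add0n.
Qed.

(** Prepending [S] turns a resolution of the ideal into one of the quotient: homological degrees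
    move up by one and the augmentation becomes the first differential. *)
Definition quotient_complex F : free_complex :=
  @FreeComplex k N (fun i => if i is j.+1 then rank F j else 1%N)
    (fun i => match i with 0 => fun _ => 0 | j.+1 => @gdeg _ _ F j end)
    (fun i => match i with 0 => aug F | j.+1 => diff F j end)
    1.

Lemma quotient_resolution J F : resolves_ideal J F ->
  is_resolution J (quotient_complex F).
Proof.
case=> hJ h0 h1.
have augE (x : 'rV_1) : @augment _ _ (quotient_complex F) x = x 0 0.
  by rewrite /augment mulmx1.
split=> [p|x|[|i] x /=]; last exact: h1.
- by exists (const_mx p); rewrite augE mxE subrr; apply/hJ; exists 0; rewrite /augment mul0mx mxE.
- rewrite augE hJ; split=> [[y xy]|[y ->]]; exists y => //.
  by apply/matrixP=> a b; rewrite !ord1 xy.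
rewrite -h0; split=> [xa|xa]; first by rewrite /augment xa mxE.
by apply/matrixP=> a b; rewrite !ord1 [RHS]mxE.
Qed.

(** Every differential has entries homogeneous of degree [e] or [d]; as both are positive, constant
    terms vanish. *)
Lemma quotient_minimal J F e d : (0 < e)%N -> (0 < d)%N -> pure_graded e d F ->
  resolves_ideal J F -> minimal_graded_free_resolution J (quotient_complex F).
Proof.
move=> e0 d0 [hg ha hd] rF.
have pos_coeff0 (p : S) c : (0 < c)%N -> p \is c.-homog -> p@_0%MM = 0.
  move=> c0 hp; apply/eqP; apply: contraTT c0 => /(@zhomog_coeff0 _ _ (Posz c)).
  by move/(_ hp) => [->].
split; [split=> [a|[|i] a b /=]| exact: quotient_resolution|move=> [|i] a b /=].
- by rewrite !ord1 mxE; apply: dhomog1.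
- by rewrite subr0 hg muln0 addn0; apply: ha.
- have -> : gdeg a - gdeg b = Posz d by rewrite /= (hg i.+1) (hg i); lia.
  exact: hd.
- exact: pos_coeff0 e0 (ha _ _).
exact: pos_coeff0 d0 (hd _ _ _).
Qed.

End Grading.

(** * Products of monomial ideals *)

Section MonomialProducts.
Context {k : fieldType} {N : nat}.
Local Notation S := {mpoly k[N]}.
Local Open Scope ring_scope.
Implicit Types (a c m w : 'X_{1..N}) (p q : S) (b : nat -> bool).

Definition coprime_mnm a c : Prop := forall i, (a i == 0%N) || (c i == 0%N).

Lemma coprime_lemD a c m : coprime_mnm a c -> (a <= c + m)%MM -> (a <= m)%MM.
Proof.
move=> ac /mnm_lepP acm; apply/mnm_lepP=> i; have := acm i; rewrite mnmDE.
by case/orP: (ac i) => /eqP->.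
Qed.

Lemma coprime_mnmD a c m : coprime_mnm a m -> coprime_mnm c m -> coprime_mnm (a + c) m.
Proof.
move=> am cm i; rewrite mnmDE addn_eq0.
by have := am i; have := cm i; case: eqP; case: eqP; case: eqP.
Qed.

Lemma coprime_mnm_sum (I : Type) (r : seq I) (P : pred I) (F : I -> 'X_{1..N}) m :
  (forall i, P i -> coprime_mnm (F i) m) ->
  coprime_mnm (\sum_(i <- r | P i) F i)%MM m.
Proof.
move=> hF; elim/big_ind: _ => // [i|x y]; [by rewrite mnm0E|exact: coprime_mnmD].
Qed.

Lemma mpolyX_neq0 m : 'X_[m] != 0 :> S.
Proof. by rewrite -msupp_eq0 msuppX. Qed.

Definition monomial_ideal (G : 'X_{1..N} -> Prop) : S -> Prop :=
  ideal_gen (fun p => exists2 g, G g & p = 'X_[g]).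

(** Membership can thus be tested on the support, term by term. *)
Lemma monomial_idealP (G : 'X_{1..N} -> Prop) p :
  monomial_ideal G p <-> (forall m, m \in msupp p -> exists2 g, G g & (g <= m)%MM).
Proof.
split.
  move: p; apply: ideal_gen_ind => [m|p q hp hq m|p _ [g Gg ->] m].
  - by rewrite msupp0.
  - by move/msuppD_le; rewrite mem_cat => /orP[/hp|/hq].
  rewrite (perm_mem (msuppMX _ _)) => /mapP[m' _ ->].
  by exists g => //; apply: lem_addr.
move=> hp; rewrite [p]mpolyE big_seq; elim/big_ind: _ => [|q r|m /hp[g Gg gm]].
- exact: ideal_gen0.
- exact: ideal_gen_add.
rewrite -(submK gm) mpolyXD scalerAl; apply: ideal_gen_mull.
by apply: ideal_gen_gen; exists g.
Qed.

Lemma mpolyX_dvdP m p : (forall m', m' \in msupp p -> (m <= m')%MM) ->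
  exists q, p = 'X_[m] * q.
Proof.
move=> hp; exists (\sum_(m' <- msupp p) p@_m' *: 'X_[m' - m]).
rewrite {1}[p]mpolyE mulr_sumr big_seq [RHS]big_seq; apply: eq_bigr => m' /hp mm'.
by rewrite -scalerAr -mpolyXD addmC submK.
Qed.

(** Supplies the syzygy hypothesis of [cone_resolves]. Each monomial of ['X_[a] * p] is divisible by
    ['X_[c]], so by coprimality those of [p] are; dividing by ['X_[c]] stays in the ideal because
    its generators are coprime to [c]. *)
Lemma monomial_syzygy (G : 'X_{1..N} -> Prop) a c p q : coprime_mnm a c ->
  (forall g, G g -> coprime_mnm g c) -> monomial_ideal G p ->
  'X_[a] * p + 'X_[c] * q = 0 ->
  exists t, [/\ monomial_ideal G t, p = 'X_[c] * t & q = - 'X_[a] * t].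
Proof.
move=> ac Gc /monomial_idealP Gp pq.
have [m mp|t pt] := @mpolyX_dvdP c p.
  apply: (@coprime_lemD _ a).
    by move=> i; rewrite orbC; apply: ac.
  have : (a + m)%MM \in msupp (q * 'X_[c]).
    rewrite mcoeff_msupp; have /eqP := pq; rewrite addr_eq0 mulrC => /eqP.
    move/(congr1 (mcoeff (a + m)%MM)); rewrite mcoeffMX mcoeffN mulrC => pa.
    by rewrite -oppr_eq0 -pa -mcoeff_msupp.
  by rewrite (perm_mem (msuppMX _ _)) => /mapP[m' _ ->]; apply: lem_addr.
exists t; split=> //.
  apply/monomial_idealP=> m mt.
  have [|g Gg gm] := Gp (c + m)%MM.
    by rewrite pt mulrC (perm_mem (msuppMX _ _)); apply/mapP; exists m.
  by exists g => //; apply: coprime_lemD gm; apply: Gc.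
apply: (mulfI (mpolyX_neq0 c)); apply/eqP; rewrite -subr_eq0; apply/eqP.
by rewrite -[RHS]pq pt mulNr mulrN opprK addrC mulrCA.
Qed.

Definition choice_mnm w (s : nat -> bool -> 'X_{1..N}) n b : 'X_{1..N} :=
  (w + \sum_(i < n) s i (b i))%MM.

Definition product_ideal w (s : nat -> bool -> 'X_{1..N}) n : S -> Prop :=
  monomial_ideal (fun g => exists b, g = choice_mnm w s n b).

Lemma product_idealS w s n p : product_ideal w s n.+1 p <->
  exists q r, [/\ product_ideal w s n q, product_ideal w s n r
    & p = 'X_[s n false] * q + 'X_[s n true] * r].
Proof.
split.
  move: p; apply: ideal_gen_ind => [|p p'|p _ [g [b ->] ->]].
  - by exists 0, 0; rewrite !mulr0 addr0; split=> //; apply: ideal_gen0.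
  - move=> [q [r [hq hr ->]]] [q' [r' [hq' hr' ->]]].
    exists (q + q'), (r + r'); split; [exact: ideal_gen_add..|].
    by rewrite !mulrDr addrACA.
  have Jg : product_ideal w s n (p * 'X_[choice_mnm w s n b]).
    by apply/ideal_gen_mull/ideal_gen_gen; exists (choice_mnm w s n b) => //; exists b.
  rewrite /choice_mnm big_ord_recr /= addmA mpolyXD mulrA mulrC.
  have J0 : product_ideal w s n 0 by apply: ideal_gen0.
  case: (b n); first by exists 0, (p * 'X_[choice_mnm w s n b]); rewrite mulr0 add0r.
  by exists (p * 'X_[choice_mnm w s n b]), 0; rewrite mulr0 addr0.
have Jn (c : bool) q : product_ideal w s n q -> product_ideal w s n.+1 ('X_[s n c] * q).
  move: q; apply: ideal_gen_ind => [|q r|q _ [g [b ->] ->]].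
  - by rewrite mulr0; apply: ideal_gen0.
  - by rewrite mulrDr; apply: ideal_gen_add.
  rewrite mulrCA; apply/ideal_gen_mull/ideal_gen_gen; rewrite -mpolyXD.
  (* Prescribing the choice at [n] leaves the factors below [n] unchanged. *)
  pose b' i := if i == n then c else b i.
  exists (choice_mnm w s n.+1 b'); first by exists b'.
  rewrite /choice_mnm big_ord_recr /= /b' eqxx addmC addmA; congr 'X_[_ + _ + _].
  by apply: eq_bigr => i _; rewrite ltn_eqF.
by case=> [q [r [hq hr ->]]]; apply: ideal_gen_add; apply: Jn.
Qed.

Lemma product_resolves e d w s n :
  (forall i (c : bool), (i < n)%N -> coprime_mnm w (s i c)) ->
  (forall i i' (c c' : bool), (i < n)%N -> (i' < n)%N -> (i, c) != (i', c') ->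
     coprime_mnm (s i c) (s i' c')) ->
  resolves_ideal (product_ideal w s n)
    (product_complex e d 'X_[w] (fun i => 'X_[s i false]) (fun i => 'X_[s i true]) n).
Proof.
elim: n => [|n IHn] hw hs /=.
  have [h0 h1 h2] := principal_resolves e d (mpolyX_neq0 w).
  split=> // p; rewrite -h0; split.
    move: p; apply: ideal_gen_ind => [|p q [p' ->] [q' ->]|p _ [g [b ->] ->]].
    - by exists 0; rewrite mul0r.
    - by exists (p' + q'); rewrite mulrDl.
    by exists p; rewrite /choice_mnm big_ord0 addm0.
  case=> [q ->]; apply/ideal_gen_mull/ideal_gen_gen.
  exists w => //; exists (fun=> true).
  by rewrite /choice_mnm big_ord0 addm0.
have {}IHn := IHn (fun i (c : bool) ni => hw i c (ltnW ni))
  (fun i i' (c c' : bool) ni ni' => hs i i' c c' (ltnW ni) (ltnW ni')).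
have [|h0 h1 h2] := cone_resolves (d * n.+1 + e) d (u := 'X_[s n false])
    (mpolyX_neq0 (s n true)) IHn.
  move=> p q hp _; apply: monomial_syzygy hp; first by apply: hs; rewrite // xpair_eqE eqxx.
  move=> g [b ->]; apply: coprime_mnmD; first exact: hw.
  apply: coprime_mnm_sum => i _; apply: hs => //; first exact: ltnW (ltn_ord i).
  by rewrite xpair_eqE ltn_eqF.
by split=> // p; rewrite -h0 product_idealS.
Qed.

Lemma product_ideal_homogeneous w s n : homogeneous_ideal (product_ideal w s n).
Proof.
apply: homogeneous_ideal_gen => p [g _ ->]; exists (mdeg g).
by rewrite dhomogX.
Qed.

Theorem product_ideal_betti e d w s n (I : S -> Prop) :
  (0 < n)%N -> (0 < d)%N -> mdeg w = e ->
  (forall i (c : bool), (i < n)%N -> mdeg (s i c) = d) ->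
  (forall i (c : bool), (i < n)%N -> coprime_mnm w (s i c)) ->
  (forall i i' (c c' : bool), (i < n)%N -> (i' < n)%N -> (i, c) != (i', c') ->
     coprime_mnm (s i c) (s i' c')) ->
  (forall p, I p <-> product_ideal w s n p) ->
  [/\ betti I 0 (Posz 0) = 1%N,
      forall (i : nat) (j : int), betti I i.+1 j =
        (if j == Posz (d * n + e + d * i) then 'C(n, i) * 2 ^ (n - i) else 0)%N
    & has_pure_resolution I].
Proof.
move=> n0 d0 we sd hw hs hI.
(* Extensionality turns the pointwise equivalence into an equality, so that [betti] can be
   rewritten. *)
have -> : I = product_ideal w s n.
  by apply: functional_extensionality => p; apply: propositional_extensionality.
have rF := product_resolves e d hw hs.
set F := product_complex _ _ _ _ _ _ in rF.
have hpure : pure_graded (d * n + e) d F.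
  by apply: product_pure => [|i ni|i ni]; rewrite dhomogX /= ?we ?sd.
have hF : minimal_graded_free_resolution (product_ideal w s n) (quotient_complex F).
  by apply: (quotient_minimal _ d0 hpure rF); rewrite addn_gt0 muln_gt0 d0 n0.
have hom := product_ideal_homogeneous w s n.
have [hg _ _] := hpure; split=> [|i j|].
- rewrite (bettiE _ _ hom hF) -[RHS](card_ord 1) -cardsT; apply: eq_card => a.
  by rewrite !inE.
- rewrite (bettiE _ _ hom hF) -(rank_product e d 'X_[w] (fun i => 'X_[s i false] : S)
    (fun i => 'X_[s i true])) -/F eq_sym; case: eqP => [jE|jE].
    rewrite -[RHS]card_ord -cardsT; apply: eq_card => a.
    by rewrite !inE /= hg jE eqxx.
  apply: eq_card0 => a; rewrite inE /= hg; exact/eqP.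
exists (quotient_complex F); split=> // -[|i]; first by exists 0.
by exists (Posz (d * n + e + d * i)) => a; apply: hg.
Qed.

End MonomialProducts.

(** * Chains of the diamond posets *)

Section Coordinates.

(* [(i, 0)] is the [i]-th bottleneck, [(i, 1)] and [(i, 2)] are the two middle
   elements between [(i, 0)] and [(i + 1, 0)]. *)
Definition is_coord (n : nat) (c : nat * nat) : bool :=
  ((c.1 < n) && (c.2 < 3)) || (c == (n, 0))%N.

Definition coord_lt (c c' : nat * nat) : bool :=
  (c.1 < c'.1)%N || [&& c.1 == c'.1, c.2 == 0%N & c'.2 != 0%N].

Definition coord_covers (c c' : nat * nat) : bool :=
  if c.2 == 0%N then (c'.1 == c.1) && (c'.2 != 0%N)
  else (c'.1 == c.1.+1) && (c'.2 == 0%N).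

(** An order isomorphism onto the coordinates of a pile of [n] diamonds, stated without making the
    coordinates a poset. *)
Definition diamond_coords n {d} (P : finPOrderType d) (f : P -> nat * nat) : Prop :=
  [/\ injective f, forall x, is_coord n (f x),
      forall c, is_coord n c -> exists x, f x = c
    & forall x y, (x < y)%O = coord_lt (f x) (f y)].

Lemma D1_coords : diamond_coords 1 (fun x : D1 => (val x %/ 3, val x %% 3)%N).
Proof.
split.
- by move=> x y [h1 h2]; apply: val_inj; rewrite /= (divn_eq x 3) h1 h2 -divn_eq.
- by case; do 4?[case=> //].
- move=> [i r]; rewrite /is_coord /= => /orP[/andP[]|/eqP[-> ->]]; last by exists D1max.
  case: i => // _ r3; exists (inord r : 'I_4).
  by rewrite /= inordK; [rewrite divn_small // modn_small|apply: ltn_trans r3 _].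
by move=> x y; rewrite D1_ltE; case: x => x hx; case: y => y hy; move: x y hx hy;
  do 4?[case=> //]; do 4?[case=> //].
Qed.

(** The added diamond is shifted up by [n] levels; its minimum inherits the coordinate [(n, 0)] of
    the removed maximum. *)
Lemma osum_D1_coords n (P : finPOrderType diamond_display) (f : P -> nat * nat) :
  diamond_coords n f -> exists f', @diamond_coords n.+1 _ (osum (remove_max P) D1) f'.
Proof.
move=> [f_inj f_coord f_surj f_lt].
have [D_inj D_coord D_surj D_lt] := D1_coords.
have [T fT] : exists x, f x = (n, 0%N) by apply: f_surj; rewrite /is_coord eqxx orbT.
have T_max : is_maximum T.
  apply/forallP=> y; rewrite le_eqVlt -(inj_eq f_inj) f_lt fT /coord_lt.
  by case/orP: (f_coord y) => [/andP[->]|->] //; rewrite orbT.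
have f_lev (u : remove_max P) : ((f (val u)).1 < n)%N.
  have := valP u; rewrite (is_maximumE _ T_max) -(inj_eq f_inj) fT => /negPf uT.
  by have := f_coord (val u); rewrite /is_coord uT orbF => /andP[].
exists (fun z : osum (remove_max P) D1 =>
  match z with inl u => f (val u) | inr e => (n + val e %/ 3, val e %% 3)%N end).
split.
- move=> [u|e] [u'|e'] /=.
  + by move/f_inj/val_inj->.
  + by move=> h; have := f_lev u; rewrite h /= ltnNge leq_addr.
  + by move=> h; have := f_lev u'; rewrite -h /= ltnNge leq_addr.
  by case=> /addnI h1 h2; congr inr; apply: D_inj; rewrite h1 h2.
- case=> [u|e] /=.
    have := f_lev u; have := f_coord (val u); rewrite /is_coord => /orP[/andP[_ ->] un|/eqP->].
      by rewrite ltnW.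
    by rewrite ltnn.
  have := D_coord e; rewrite /is_coord /= -[n.+1]addn1 ltn_add2l.
  by case/orP=> [->//|/eqP[-> ->]]; rewrite eqxx orbT.
- move=> [i r] hc; have [lin|nin] := ltnP i n.
    have [|x fx] := f_surj (i, r).
      by move: hc; rewrite /is_coord lin /= => /orP[/andP[_ ->]//|/eqP[ein]]; lia.
    have xT : ~~ is_maximum x.
      by rewrite (is_maximumE _ T_max) -(inj_eq f_inj) fx fT; apply/eqP=> -[]; lia.
    by exists (inl (exist _ x xT)).
  have [|e he] := D_surj (i - n, r)%N.
    by move: hc; rewrite /is_coord /= !xpair_eqE; lia.
  by exists (inr e); case: he => -> ->; rewrite subnKC.
move=> [u|e] [u'|e'] /=; rewrite osum_ltE /=.
- exact: f_lt.
- by rewrite /coord_lt /= (leq_trans (f_lev u)) // leq_addr.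
- have un : ((f (val u')).1 < n + val e %/ 3)%N by rewrite ltn_addr ?f_lev.
  by rewrite /coord_lt /= ltnNge ltnW // gtn_eqF.
by rewrite D_lt /coord_lt /= ltn_add2l eqn_add2l.
Qed.

Lemma diamond_has_coords n : (0 < n)%N ->
  exists f : diamond n -> nat * nat, diamond_coords n f.
Proof.
case: n => // n _; elim: n => [|n [f hf]]; last exact: osum_D1_coords hf.
by eexists; apply: D1_coords.
Qed.

End Coordinates.

(** * Maximal chains as sequences of binary choices *)

Section DiamondChains.
Context {d : Order.disp_t} (P : finPOrderType d) (n : nat) (f : P -> nat * nat).
Context (hf : diamond_coords n f).

Let f_inj : injective f. Proof. by case: hf. Qed.
Let f_lt x y : (x < y)%O = coord_lt (f x) (f y). Proof. by case: hf. Qed.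

(** The rank function: bottlenecks have even height, middle elements odd height. *)
Definition height (x : P) : nat := ((f x).1).*2 + ((f x).2 != 0%N).

Lemma coord_level x : ((f x).1 <= n)%N.
Proof. by case: hf => _ /(_ x)/orP[/andP[/ltnW]|/eqP->]. Qed.

Lemma coord_mid x : (f x).2 != 0%N -> ((f x).1 < n)%N && ((f x).2 < 3)%N.
Proof. by case: hf => _ /(_ x)/orP[//|/eqP->]. Qed.

Lemma coord_inv c : is_coord n c -> exists x, f x = c.
Proof. by case: hf => _ _ h _; apply: h. Qed.

Lemma height_le x : (height x <= n.*2)%N.
Proof.
rewrite /height; case: eqP => [_|/eqP/coord_mid/andP[h _]].
  by rewrite addn0 leq_double coord_level.
by rewrite addn1 ltn_double.
Qed.

Lemma diamond_covers x y : covers x y = coord_covers (f x) (f y).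
Proof.
rewrite /covers f_lt; case E: (f x) => [i r]; case E': (f y) => [i' r'].
apply/andP/idP => [[lxy /forallP hz]|].
  have hc c : is_coord n c -> ~~ (coord_lt (i, r) c && coord_lt c (i', r')).
    by case/coord_inv => z fz; have := hz z; rewrite !f_lt E E' fz.
  have iyn : (i' <= n)%N by have := coord_level y; rewrite E'.
  have hmid : (i < n)%N -> is_coord n (i, 1%N) by rewrite /is_coord /= => ->.
  have hnext : (i < n)%N -> is_coord n (i.+1, 0%N).
    by rewrite /is_coord /= andbT xpair_eqE andbT orbC -leq_eqVlt.
  move: lxy; rewrite /coord_lt /coord_covers /=; case: ltngtP => [ii _|//|->] /=.
    have iln := leq_trans ii iyn.
    have := hc _ (hmid iln); have := hc _ (hnext iln); rewrite /coord_lt /=.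
    case: (eqVneq r 0%N) => r0 /=; lia.
  by case/andP=> ->.
rewrite /coord_covers /coord_lt /= => hxy; split; first by case: eqVneq hxy; lia.
apply/forallP=> z; rewrite !f_lt E E'; case: (f z) => j s; rewrite /coord_lt /=.
by case: eqVneq hxy; lia.
Qed.

Lemma covers_height x y : covers x y -> height y = (height x).+1.
Proof.
rewrite diamond_covers /coord_covers /height; case: eqP => _ /andP[/eqP-> ] => [->|/eqP->] /=.
  by rewrite addn0 addn1.
by rewrite addn0 addn1 doubleS.
Qed.

Lemma height_nth x0 (s : seq P) i : saturated_chain s -> (i < size s)%N ->
  height (nth x0 s i) = (height (nth x0 s 0) + i)%N.
Proof.
move=> /(sortedP x0) hs; elim: i => [|i IHi] si; first by rewrite addn0.
by rewrite (covers_height (hs _ si)) IHi ?addnS // ltnW.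
Qed.

Lemma size_saturated (s : seq P) : saturated_chain s -> (size s <= n.*2.+1)%N.
Proof.
case: s => // x s hs; have := height_le (nth x (x :: s) (size s)).
by rewrite (height_nth x hs) ?ltnSn // => /(leq_trans (leq_addl _ _)).
Qed.

(** Heights increase by one along the chain and never exceed [n.*2], so a chain of [n.*2.+1]
    elements must start at height 0. *)
Lemma height_nth_full x0 (s : seq P) i : saturated_chain s -> size s = n.*2.+1 ->
  (i < size s)%N -> height (nth x0 s i) = i.
Proof.
move=> hs sz si; rewrite (height_nth x0 hs si).
have /(height_nth x0 hs) : (n.*2 < size s)%N by rewrite sz.
by have := height_le (nth x0 s n.*2); lia.
Qed.

Lemma mem_full_chain x0 (s : seq P) x : saturated_chain s -> size s = n.*2.+1 ->
  x \in s = (nth x0 s (height x) == x).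
Proof.
move=> hs sz; apply/idP/eqP => [xs|<-]; last by rewrite mem_nth // sz ltnS height_le.
have is_ : (index x s < size s)%N by rewrite index_mem.
by rewrite -{1}(nth_index x0 xs) (height_nth_full x0 hs sz is_) nth_index.
Qed.

Lemma saturated_uniq (s : seq P) : saturated_chain s -> uniq s.
Proof.
move=> hs; apply: (sorted_uniq lt_trans ltxx).
by apply: sub_sorted hs => x y /andP[].
Qed.

Lemma covers_below x : (0 < height x)%N -> exists y, covers y x.
Proof.
rewrite /height => hx; have := coord_level x; case E: (f x) hx => [i r] /= hx il.
have [c hc hcx] : exists2 c, is_coord n c & coord_covers c (i, r).
  case: eqP hx => [-> /=|r0 _].
    case: i il {E} => // i il _; exists (i, 1%N); rewrite /is_coord /coord_covers /= ?il //.
    by rewrite !eqxx.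
  exists (i, 0%N); last by rewrite /coord_covers /= eqxx; apply/eqP.
  have := @coord_mid x; rewrite E /= => /(_ _)/andP[]; first exact/eqP.
  by rewrite /is_coord /= => ->.
by have [y fy] := coord_inv hc; exists y; rewrite diamond_covers fy E.
Qed.

Lemma covers_above x : (height x < n.*2)%N -> exists y, covers x y.
Proof.
rewrite /height => hx; have := coord_level x; case E: (f x) hx => [i r] /= hx il.
have {hx}iln : (i < n)%N by lia.
have [c hc hcx] : exists2 c, is_coord n c & coord_covers (i, r) c.
  have [->|r0] := eqVneq r 0%N.
    by exists (i, 1%N); rewrite /is_coord /coord_covers /= ?iln ?eqxx.
  exists (i.+1, 0%N); last by rewrite /coord_covers /= (negPf r0) !eqxx.
  by rewrite /is_coord /= andbT xpair_eqE andbT orbC -leq_eqVlt.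
by have [y fy] := coord_inv hc; exists y; rewrite diamond_covers E fy.
Qed.

(** A chain of full size has one element of each height, so a saturated chain containing it
    coincides with it. Conversely, a chain not reaching height 0 or [n.*2] can be prolonged at that
    end. *)
Lemma maximal_chainP (s : seq P) :
  maximal_saturated_chain s <-> saturated_chain s /\ size s = n.*2.+1.
Proof.
have [x0 _] : exists x0, f x0 = (n, 0%N) by apply: coord_inv; rewrite /is_coord eqxx orbT.
split=> [[hs maxs]|[hs sz]]; split=> //; last first.
  move=> t ht st; have sz' : size t = n.*2.+1.
    apply/eqP; rewrite eqn_leq size_saturated //= -sz.
    exact: uniq_leq_size (saturated_uniq hs) st.
  apply: (@eq_from_nth _ x0) => [|i it]; first by rewrite sz.
  have si : (i < size s)%N by rewrite sz -sz'.
  have := st _ (mem_nth x0 si); rewrite (mem_full_chain x0 _ ht sz').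
  by rewrite (height_nth_full x0 hs sz si) => /eqP.
have no_longer t : saturated_chain t -> {subset s <= t} -> size t <> (size s).+1.
  by move=> ht st; rewrite (maxs t ht st); lia.
case: s hs maxs no_longer => [|x s] hs maxs no_longer; first by case: (@no_longer [:: x0]).
have hx : height x = 0%N.
  apply/eqP; rewrite -leqn0 leqNgt; apply/negP=> /covers_below[y yx].
  case: (@no_longer [:: y, x & s]) => //; first by rewrite /saturated_chain /= yx.
  by move=> z zs; rewrite inE zs orbT.
have hl : height (last x s) = n.*2.
  apply/eqP; rewrite eqn_leq height_le leqNgt; apply/negP=> /covers_above[y yx].
  case: (@no_longer (rcons (x :: s) y)).
  - by rewrite /saturated_chain /= rcons_path yx andbT.
  - by move=> z zs; rewrite mem_rcons inE zs orbT.
  by rewrite size_rcons.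
by have := height_nth x hs (ltnSn _); rewrite nth_last /= hx hl => ->.
Qed.

(** Bottlenecks always belong to the chain; at level [i], [true] selects the middle element [(i, 2)]
    and [false] selects [(i, 1)]. *)
Definition follows (b : nat -> bool) (s : seq P) : Prop :=
  forall x, x \in s = (((f x).2 != 0%N) ==> (((f x).2 == 2%N) == b (f x).1)).

Lemma chain_follows (s : seq P) : saturated_chain s -> size s = n.*2.+1 ->
  exists b, follows b s.
Proof.
case: s => // x0 s' hs sz; set s := x0 :: s' in hs sz *.
(* Positions are heights in a full chain, so position [i.*2.+1] holds the middle element of level
   [i]. *)
exists (fun i => (f (nth x0 s i.*2.+1)).2 == 2%N) => x.
rewrite (mem_full_chain x0 x hs sz) -(inj_eq f_inj).
have hx : (height x < size s)%N by rewrite sz ltnS height_le.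
have := height_nth_full x0 hs sz hx; rewrite [in X in X -> _]/height /height.
have := @coord_mid x; case: (f x) => [i r] /=.
case: eqP => [->|/eqP r0] /=.
  move=> _; rewrite addn0; case: (f _) => [j t] /=; rewrite xpair_eqE.
  by case: eqP; lia.
move=> /(_ isT)/andP[_ r3]; rewrite addn1.
have := @coord_mid (nth x0 s i.*2.+1); case: (f _) => [j t] /=; rewrite xpair_eqE.
case: eqP => [|/eqP t0]; first by lia.
by move=> /(_ isT)/andP[_ t3]; lia.
Qed.

Lemma choice_chain (b : nat -> bool) :
  exists s : seq P, [/\ saturated_chain s, size s = n.*2.+1 & follows b s].
Proof.
have [x0 _] : exists x0, f x0 = (n, 0%N) by apply: coord_inv; rewrite /is_coord eqxx orbT.
(* The coordinate at height [t]: a bottleneck for even [t], the chosen middle element for odd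
   [t]. *)
pose c t := (t./2, if odd t then (b t./2).+1 else 0%N).
have hc t : (t <= n.*2)%N -> is_coord n (c t).
  by rewrite /is_coord /c /= xpair_eqE; case: (b _); case: odd (odd_double_half t); lia.
pose pt t := odflt x0 [pick x | f x == c t].
have ptE t : (t <= n.*2)%N -> f (pt t) = c t.
  move=> /hc/coord_inv[x fx]; rewrite /pt; case: pickP => [y /eqP//|/(_ x)].
  by rewrite fx eqxx.
pose s := mkseq pt n.*2.+1.
have sz : size s = n.*2.+1 by rewrite size_mkseq.
have hs : saturated_chain s.
  apply/(sortedP x0) => i; rewrite sz ltnS => hi.
  rewrite !nth_mkseq ?ltnS ?(ltnW hi) // diamond_covers !ptE ?(ltnW hi) //.
  by rewrite /c /coord_covers /= uphalf_half; case: odd => //=; rewrite ?eqxx ?add0n ?eqxx.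
exists s; split=> // x.
rewrite (mem_full_chain x0 x hs sz) nth_mkseq ?ltnS ?height_le // -(inj_eq f_inj).
rewrite ptE ?height_le // /c /height; have := @coord_mid x.
case: (f x) => [i r] /=; case: eqP => [->|/eqP r0] /=.
  by rewrite addn0 odd_double doubleK eqxx.
move=> /(_ isT)/andP[_ r3]; rewrite addn1 /= odd_double uphalf_double xpair_eqE eqxx /=.
by case: (b i); lia.
Qed.

Definition edge_level (e : edge P) : nat := (f (val e).1).1.
(** Exactly one end of an edge is a middle element, and it may be either end. *)
Definition edge_side (e : edge P) : bool := ((f (val e).1).2 == 2%N) || ((f (val e).2).2 == 2%N).

(** The ends of an edge have consecutive heights, hence occupy consecutive positions once both lie
    in the chain. *)
Lemma edge_in_chainE (s : seq P) (e : edge P) : saturated_chain s -> size s = n.*2.+1 ->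
  edge_in_chain s e = ((val e).1 \in s) && ((val e).2 \in s).
Proof.
move=> hs sz; case: e => [[x y] /= xy]; rewrite /edge_in_chain /=.
have szz : size (zip s (behead s)) = n.*2 by rewrite size_zip size_behead sz /=; lia.
have nthz i : (i < n.*2)%N -> nth (x, x) (zip s (behead s)) i = (nth x s i, nth x s i.+1).
  by move=> ii; rewrite nth_zip_cond szz ii nth_behead.
apply/idP/andP=> [/(nthP (x, x))[i]|[]].
  rewrite szz => hi; rewrite nthz // => -[hx hy].
  have := @mem_nth _ x s i.+1; have := @mem_nth _ x s i.
  by rewrite hx hy sz !ltnS (ltnW hi) hi => -> // ->.
rewrite !(mem_full_chain x _ hs sz) (covers_height xy) => /eqP hx /eqP hy.
have hxn : (height x < n.*2)%N by have := height_le y; rewrite (covers_height xy).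
by rewrite -{1}hx -hy -nthz // mem_nth // szz.
Qed.

Lemma edge_follows b (s : seq P) (e : edge P) : saturated_chain s -> size s = n.*2.+1 ->
  follows b s -> edge_in_chain s e = (edge_side e == b (edge_level e)).
Proof.
move=> hs sz fs; rewrite edge_in_chainE // !fs /edge_side /edge_level.
case: e => [[x y] /= xy]; move: xy; rewrite diamond_covers /coord_covers.
case: eqVneq => [->|r0] /andP[/eqP->]; first by move=> ->.
by move/eqP=> ->; rewrite ?andbT ?orbF.
Qed.

(** The two edges are those entering and leaving the chosen middle element. *)
Lemma card_edge_choice i c : (i < n)%N ->
  #|[pred e : edge P | (edge_level e == i) && (edge_side e == c)]| = 2%N.
Proof.
move=> iln.
have [x fx] : exists x, f x = (i, 0%N).
  by apply: coord_inv; rewrite /is_coord iln.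
have [y fy] : exists y, f y = (i, c.+1).
  by apply: coord_inv; rewrite /is_coord iln /=; case: c.
have [z fz] : exists z, f z = (i.+1, 0%N).
  by apply: coord_inv; rewrite /is_coord /= andbT xpair_eqE andbT orbC -leq_eqVlt.
have xy : covers x y by rewrite diamond_covers fx fy /coord_covers /= eqxx.
have yz : covers y z by rewrite diamond_covers fy fz /coord_covers /= !eqxx.
pose e1 : edge P := exist _ (x, y) xy; pose e2 : edge P := exist _ (y, z) yz.
have <- : #|[set e1; e2]| = 2%N.
  by rewrite cards2 -val_eqE /= xpair_eqE -(inj_eq f_inj) fx fy xpair_eqE andbF.
apply: eq_card => -[[u v] uv]; rewrite !inE -!val_eqE /= !xpair_eqE -!(inj_eq f_inj).
rewrite fx fy fz /edge_level /edge_side /=; move: uv (@coord_mid u) (@coord_mid v).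
rewrite diamond_covers; case: (f u) => [j r]; case: (f v) => [j' r'] /=.
rewrite /coord_covers /= !xpair_eqE; case: eqP => [->|/eqP r0] /andP[/eqP-> hr'].
  by move=> _ /(_ hr')/andP[_ r3]; case: (c); lia.
by move=> /(_ isT)/andP[_ r3] _; rewrite (eqP hr'); case: (c); lia.
Qed.

Lemma card_bottlenecks : #|[pred x | (f x).2 == 0%N]| = n.+1.
Proof.
have /fin_all_exists[z fz] (i : 'I_n.+1) : exists x, f x = (val i, 0%N).
  apply: coord_inv; rewrite /is_coord /= andbT xpair_eqE andbT orbC -leq_eqVlt.
  by rewrite -ltnS.
have z_inj : injective z by move=> i j /(congr1 f); rewrite !fz => -[/val_inj].
rewrite -[RHS]card_ord -cardsT -(card_imset _ z_inj); apply: eq_card => x.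
rewrite inE; apply/eqP/imsetP => [fx|[i _ ->]]; last by rewrite fz.
exists (Ordinal (coord_level x : (f x).1 < n.+1)%N) => //.
by apply: f_inj; rewrite fz /= -fx -surjective_pairing.
Qed.

Lemma card_mid_choice i c : (i < n)%N ->
  #|[pred x | [&& (f x).2 != 0%N, (f x).1 == i & ((f x).2 == 2%N) == c]]| = 1%N.
Proof.
move=> iln; have [y fy] : exists y, f y = (i, c.+1).
  by apply: coord_inv; rewrite /is_coord iln /=; case: c.
rewrite -[RHS](card1 y); apply: eq_card => x; rewrite !inE -(inj_eq f_inj) fy.
have := @coord_mid x; case: (f x) => [j r] /=; rewrite xpair_eqE.
have [->|r0] := eqVneq r 0%N; first by case: (c); lia.
by move=> /(_ isT)/andP[_]; case: (c); lia.
Qed.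

End DiamondChains.

(** * The two ideals *)

Section ChoiceIdeals.
Context {k : fieldType} {N : nat} {T : finType}.
Local Notation S := {mpoly k[N]}.
Local Open Scope ring_scope.
Context (g : T -> 'I_N) (g_inj : injective g).
Context (A : pred T) (lev : T -> nat) (side : T -> bool).

Definition support_mnm (Q : pred T) : 'X_{1..N} := (\sum_(x | Q x) U_(g x))%MM.

Lemma mdeg_support (Q : pred T) : mdeg (support_mnm Q) = #|Q|.
Proof. by rewrite mdeg_sum; under eq_bigr do rewrite mdeg1; rewrite sum1_card. Qed.

Lemma coprime_support (Q Q' : pred T) : (forall x, Q x -> ~~ Q' x) ->
  coprime_mnm (support_mnm Q) (support_mnm Q').
Proof.
move=> QQ' i; rewrite /support_mnm !mnm_sumE.
have [/existsP[x /andP[Qx /eqP gx]]|nQ] := boolP [exists x, Q x && (g x == i)].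
  rewrite [X in _ || (X == _)]big1 ?orbT // => y Q'y; rewrite mnm1E -gx.
  case: eqP => // /g_inj xy; have := QQ' x Qx.
  by rewrite -xy Q'y.
rewrite big1 // => x Qx; rewrite mnm1E; case: eqP => // gx.
by case/existsP: nQ; exists x; rewrite Qx gx eqxx.
Qed.

Definition choice_support (i : nat) (c : bool) : 'X_{1..N} :=
  support_mnm (fun x => [&& A x, lev x == i & side x == c]).

Lemma choice_mnmE n (b : nat -> bool) : (forall x, A x -> (lev x < n)%N) ->
  choice_mnm (support_mnm (fun x => ~~ A x)) choice_support n b =
  support_mnm (fun x => A x ==> (side x == b (lev x))).
Proof.
move=> hlev; rewrite /choice_mnm /support_mnm [RHS](bigID (fun x => ~~ A x)) /=.
congr (_ + _)%MM; first by apply: eq_bigl => x; case: (A x) => //=; rewrite andbF.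
case: n hlev => [|n] hlev.
  by rewrite big_ord0 big1 // => x /andP[_ /negPn/hlev].
(* The sum is grouped by level; [inord] is faithful here because levels of elements of [A] lie below
   the bound. *)
rewrite [RHS](partition_big (fun x => inord (lev x) : 'I_n.+1) predT) //=.
apply: eq_bigr => i _; apply: eq_bigl => x.
case Ax : (A x) => //=.
rewrite -(inj_eq val_inj) /= inordK ?hlev //.
by case: (eqVneq (lev x) i) => [->|_]; rewrite /= ?andbT ?andbF.
Qed.

(** The common form of both ideals: the [e] variables outside [A] divide every generator, and each
    choice of side at a level contributes [d] variables. *)
Theorem choice_ideal_betti e d n (G : S -> Prop) :
  (0 < n)%N -> (0 < d)%N -> (forall x, A x -> (lev x < n)%N) ->
  #|[pred x | ~~ A x]| = e ->
  (forall i c, (i < n)%N -> #|[pred x | [&& A x, lev x == i & side x == c]]| = d) ->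
  (forall p, G p <-> exists b : nat -> bool,
     p = \prod_(x | A x ==> (side x == b (lev x))) 'X_(g x)) ->
  [/\ betti (ideal_gen G) 0 (Posz 0) = 1%N,
      forall (i : nat) (j : int), betti (ideal_gen G) i.+1 j =
        (if j == Posz (d * n + e + d * i) then 'C(n, i) * 2 ^ (n - i) else 0)%N
    & has_pure_resolution (ideal_gen G)].
Proof.
move=> n0 d0 hlev he hd hG.
apply: (@product_ideal_betti _ _ e d (support_mnm (fun x => ~~ A x)) choice_support) => //.
- by rewrite mdeg_support.
- by move=> i c ni; rewrite mdeg_support hd.
- by move=> i c _; apply: coprime_support => x /negPf->.
- move=> i i' c c' _ _ ne; apply: coprime_support => x /and3P[_ /eqP lx /eqP sx].
  by apply: contra ne => /and3P[_]; rewrite lx sx xpair_eqE => -> ->.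
have hG' q : G q <-> exists2 m, exists b, m =
    choice_mnm (support_mnm (fun x => ~~ A x)) choice_support n b & q = 'X_[m].
  rewrite hG; split=> [[b ->]|[m [b ->] ->]]; last first.
    by exists b; rewrite choice_mnmE // mprodXE.
  by eexists; [exists b; reflexivity|rewrite choice_mnmE // mprodXE].
by move=> p; split=> -[s [hs ->]]; exists s; split=> // x /hs/hG'.
Qed.

End ChoiceIdeals.

Theorem theorem5p3 (n : nat) (hn : (1 <= n)%N) (k : fieldType)
  (yv : edge (diamond n) -> 'I_(4 * n)) (hyv : bijective yv)
  (xv : diamond n -> 'I_(3 * n + 1)) (hxv : bijective xv) :
  let I_LD := LD_ideal k yv in
  let I_path := path_ideal k xv (2 * n + 1) in
  [/\ betti I_LD 0 (Posz 0) = 1%N,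
      (forall (i : nat) (j : int), (1 <= i <= n + 1)%N ->
         betti I_LD i j =
           (if j == Posz (2 * i + 2 * n - 2)%N
            then 'C(n, i - 1) * 2 ^ (n + 1 - i) else 0)%N),
      (forall (i : nat) (j : int), (n + 1 < i)%N -> betti I_LD i j = 0%N)
    & has_pure_resolution I_LD] /\
  [/\ betti I_path 0 (Posz 0) = 1%N,
      (forall (i : nat) (j : int), (1 <= i <= n + 1)%N ->
         betti I_path i j =
           (if j == Posz (i + 2 * n)%N
            then 'C(n, i - 1) * 2 ^ (n + 1 - i) else 0)%N),
      (forall (i : nat) (j : int), (n + 1 < i)%N -> betti I_path i j = 0%N)
    & has_pure_resolution I_path].
Proof.
have [f hf] := diamond_has_coords hn; rewrite /LD_ideal /path_ideal /=; split.
  set G := (X in ideal_gen X).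
  (* Every edge depends on a choice, so [e = 0]; each side of a diamond carries two edges, so
     [d = 2]. *)
  have [|||p|h0 h hpure] := @choice_ideal_betti k _ _ yv (bij_inj hyv) predT
    (edge_level f) (edge_side f) 0 2 n G hn isT.
  - move=> [[x y] xy] _; rewrite /edge_level /=; have := height_le hf y.
    by rewrite (covers_height hf xy) /height /=; lia.
  - exact: eq_card0.
  - by move=> i c; apply: card_edge_choice.
  - rewrite /G; split=> [[s [/(maximal_chainP hf)[hs sz] ->]]|[b ->]].
      have [b fs] := chain_follows hf hs sz; exists b.
      by apply: eq_bigl => e; rewrite (edge_follows hf e hs sz fs).
    have [s [hs sz fs]] := choice_chain hf b.
    exists s; split; first by apply/(maximal_chainP hf).
    by apply: eq_bigl => e; rewrite (edge_follows hf e hs sz fs).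
  split=> // [[|i] j // /andP[_ hi]|[|i] j // hi]; rewrite h.
    have -> : (2 * n + 0 + 2 * i = 2 * i.+1 + 2 * n - 2)%N by lia.
    by rewrite subn1 addn1 subSS.
  (* Beyond homological degree [n + 1] the binomial coefficient vanishes. *)
  by rewrite bin_small ?if_same //; lia.
set G := (X in ideal_gen X).
(* The [n.+1] bottlenecks lie on every maximal chain, and each choice contributes one middle
   element, so [d = 1]. *)
have [|||p|h0 h hpure] := @choice_ideal_betti k _ _ xv (bij_inj hxv)
  (fun x => (f x).2 != 0%N) (fun x => (f x).1) (fun x => (f x).2 == 2%N)
  n.+1 1 n G hn isT.
- by move=> x /(coord_mid hf)/andP[].
- by rewrite -(card_bottlenecks hf); apply: eq_card => x; rewrite !inE negbK.
- by move=> i c; apply: card_mid_choice.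
- have nn : (2 * n + 1 = n.*2.+1)%N by lia.
  have prodE s b : saturated_chain s -> follows f b s ->
      (\prod_(v <- s) 'X_(xv v) = \prod_(x | ((f x).2 != 0%N) ==>
        (((f x).2 == 2%N) == b (f x).1)) 'X_(xv x) :> {mpoly k[_]})%R.
    move=> hs fs; rewrite big_uniq ?(saturated_uniq hs) //=.
    by apply: eq_bigl => x; rewrite fs.
  rewrite /G nn; split=> [[s [hs sz ->]]|[b ->]].
    by have [b fs] := chain_follows hf hs sz; exists b; apply: prodE.
  by have [s [hs sz fs]] := choice_chain hf b; exists s; rewrite (prodE s b).
split=> // [[|i] j // /andP[_ hi]|[|i] j // hi]; rewrite h.
  have -> : (1 * n + n.+1 + 1 * i = i.+1 + 2 * n)%N by lia.
  by rewrite subn1 addn1 subSS.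
by rewrite bin_small ?if_same //; lia.
Qed.
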